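(* Let $g=g_{\mathbf q}$ be a penalty metric on $\mathrm{SU}(2^N)$ with penalty factors $\mathbf q=(q_1,\dots,q_N)$. If $q_1\ne q_i$ for all $2\le i\le N$, then $h_{*e}(W_1)=W_1$ for all $h\in\mathrm{Aut}(\mathrm{SU}(2^N),g)$. In particular, this conclusion holds for the binomial metrics, i.e. the penalty metrics with $q_k=\left(\binom Nk3^k\right)^\alpha$ for $k=1,\dots,N$, where $\alpha>0$ is given, and for the exponential metrics, i.e. the penalty metrics with $q_k=x^{2k}$ for $k=1,\dots,N$, where $x>1$ is given.
   Context: Let $N\ge1$. Let $\sigma_0$ be the $2\times2$ identity matrix and $\sigma_1=\begin{bmatrix}0&1\\1&0\end{bmatrix}$, $\sigma_2=\begin{bmatrix}0&-i\\ i&0\end{bmatrix}$, $\sigma_3=\begin{bmatrix}1&0\\0&-1\end{bmatrix}$. Let $\mathcal I_N^0=\{0,1,2,3\}^N\setminus\{(0,\dots,0)\}$. For $I=(i_1,\dots,i_N)\in\mathcal I_N^0$ put $\tilde\sigma_I=-\sqrt{-1}\,\sigma_{i_1}\otimes\cdots\otimes\sigma_{i_N}$; these form a basis of $\mathfrak{su}(2^N)$. The weight $w(\tilde\sigma_I)$ is the number of $j$ with $i_j\ne0$, and $W_1=\mathrm{span}_{\mathbb R}\{\tilde\sigma_I\mid w(\tilde\sigma_I)=1\}$. Penalty metric: given $\mathbf q=(q_1,\dots,q_N)$ with all $q_k>0$, $g_{\mathbf q}$ is the right invariant Riemannian metric on $\mathrm{SU}(2^N)$ with $g_{\mathbf q}(\tilde\sigma_I,\tilde\sigma_J)=q_{w(\tilde\sigma_I)}\delta_{IJ}$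 on $T_e\mathrm{SU}(2^N)=\mathfrak{su}(2^N)$. $\mathrm{Aut}(\mathrm{SU}(2^N),g)$ is the group of Lie group automorphisms of $\mathrm{SU}(2^N)$ that are isometries of $g$; $h_{*e}$ is the differential at the identity $e$. *)

(* Defs.v *)
From mathcomp Require Import all_boot all_order all_algebra.
From mathcomp Require Import all_classical all_reals all_analysis.
From mathcomp Require Import complex mxtens.

Set Implicit Arguments.
Unset Strict Implicit.
Unset Printing Implicit Defensive.

Import Order.TTheory GRing.Theory Num.Theory.
Import numFieldNormedType.Exports.

Local Open Scope classical_set_scope.
Local Open Scope ring_scope.
Local Open Scope complex_scope.

Section Smoothness.
Variables (R : realType) (E F : normedModType R).

(* [V] is meant to be open and [E] finite-dimensional: the existence and
   continuity of all iterated directional derivatives up to order [k] is then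
   the usual C^k condition. *)
Fixpoint Ck (k : nat) (V : set E) (f : E -> F) : Prop :=
  (forall x, V x -> {for x, continuous f}) /\
  match k with
  | 0 => True
  | k'.+1 => forall v : E,
      (forall x, V x -> derivable f x v) /\ Ck k' V (fun x => 'D_v f x)
  end.

Definition smooth_on_open (V : set E) (f : E -> F) : Prop :=
  forall k, Ck k V f.

(* A map defined on a subset [S] of a Euclidean space is smooth when it extends
   locally to smooth maps; for an embedded submanifold [S] this is smoothness
   in the sense of manifolds. *)
Definition smooth_on (S : set E) (f : E -> F) : Prop :=
  forall x, S x -> exists (V : set E) (f' : E -> F),
    [/\ open V, V x, smooth_on_open V f' &
        forall y, V y -> S y -> f' y = f y].

End Smoothness.

Section SpecialUnitary.
Variables (R : realType) (n : nat).

Local Notation C := R[i].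
Local Notation M := 'M[C]_n.
Local Notation E := ('M[R]_n * 'M[R]_n)%type.

(* The identification of complex matrices with the real vector space of pairs
   (real part, imaginary part), which carries the topology and the real
   differential calculus. *)
Definition to_real (A : M) : E :=
  (\matrix_(i, j) complex.Re (A i j), \matrix_(i, j) complex.Im (A i j)).

Definition of_real (z : E) : M := \matrix_(i, j) (z.1 i j +i* z.2 i j).

Definition SU : set M := [set U | U \is unitarymx /\ \det U = 1].

Definition smooth_SU (h : M -> M) : Prop :=
  smooth_on (to_real @` SU) (fun z => to_real (h (of_real z))).

Definition smooth_SU_fun (f : M -> R) : Prop :=
  smooth_on (to_real @` SU) (fun z => f (of_real z) : R^o).

Definition velocity (c : R -> M) (t : R) : M :=
  of_real (derive1 (fun s : R => to_real (c s)) t).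

Definition smooth_curve (c : R -> M) : Prop :=
  (forall t, SU (c t)) /\
  smooth_on_open [set: R^o] (fun t : R^o => to_real (c t)).

Definition tangent (U : M) : set M :=
  [set v | exists c, [/\ smooth_curve c, c 0 = U & velocity c 0 = v]].

(* For smooth [h] the set below is a singleton when [v] is tangent at [U], as
   the velocity of the image curve does not depend on the curve. *)
Definition differential (h : M -> M) (U v : M) : M :=
  xget 0 [set w | exists c,
    [/\ smooth_curve c, c 0 = U, velocity c 0 = v &
        w = velocity (fun t => h (c t)) 0]].

Definition smooth_vector_field (X : M -> M) : Prop :=
  (forall U, SU U -> tangent U (X U)) /\ smooth_SU X.

(* [g U v w] is only meaningful for [U] in SU(n) and [v], [w] tangent at [U];
   similarly, a self-map of SU(n) is a function on matrices of which only the
   values on SU(n) matter. *)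
Definition riemannian_metric (g : M -> M -> M -> R) : Prop :=
  [/\ forall U v w, SU U -> tangent U v -> tangent U w -> g U v w = g U w v,
      forall U (a : R) u v w, SU U ->
        tangent U u -> tangent U v -> tangent U w ->
        g U (a%:C *: u + v) w = a * g U u w + g U v w,
      forall U v, SU U -> tangent U v -> v != 0 -> 0 < g U v v
    & forall X Y, smooth_vector_field X -> smooth_vector_field Y ->
        smooth_SU_fun (fun U => g U (X U) (Y U))].

Definition preserves_metric (g : M -> M -> M -> R) (h : M -> M) : Prop :=
  forall U v w, SU U -> tangent U v -> tangent U w ->
    g (h U) (differential h U v) (differential h U w) = g U v w.

Definition right_invariant (g : M -> M -> M -> R) : Prop :=
  forall V, SU V -> preserves_metric g (fun U => U *m V).

Definition diffeomorphism (h : M -> M) : Prop :=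
  exists k : M -> M,
    [/\ set_fun SU SU h, set_fun SU SU k,
        forall U, SU U -> k (h U) = U /\ h (k U) = U,
        smooth_SU h & smooth_SU k].

Definition isometry (g : M -> M -> M -> R) (h : M -> M) : Prop :=
  diffeomorphism h /\ preserves_metric g h.

Definition lie_group_automorphism (h : M -> M) : Prop :=
  diffeomorphism h /\
  forall U V, SU U -> SU V -> h (U *m V) = h U *m h V.

Definition Aut_SU (g : M -> M -> M -> R) : set (M -> M) :=
  [set h | lie_group_automorphism h /\ isometry g h].

End SpecialUnitary.

Section Pauli.
Variable R : realType.
Local Notation C := R[i].
Local Notation imC := (0 +i* 1 : C).

Definition mx2_of_rows (rows : seq (seq C)) : 'M[C]_2 :=
  \matrix_(i, j) nth 0 (nth [::] rows i) j.

Definition pauli (k : 'I_4) : 'M[C]_2 :=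
  nth 0 [:: 1%:M;
            mx2_of_rows [:: [:: 0; 1]; [:: 1; 0]];
            mx2_of_rows [:: [:: 0; - imC]; [:: imC; 0]];
            mx2_of_rows [:: [:: 1; 0]; [:: 0; -1]]] k.

Fixpoint tensor_prod (N : nat) : ('I_N -> 'M[C]_2) -> 'M[C]_(2 ^ N) :=
  match N with
  | 0 => fun _ => 1%:M
  | N'.+1 => fun A =>
      castmx (esym (expnS 2 N'), esym (expnS 2 N'))
        (tensmx (A ord0) (tensor_prod (fun j => A (lift ord0 j))))
  end.

Variable N : nat.

Definition multi_index := {ffun 'I_N -> 'I_4}.

Definition weight (I : multi_index) : nat := #|[pred j | I j != ord0]|.

Definition sigma_tilde (I : multi_index) : 'M[C]_(2 ^ N) :=
  (- imC) *: tensor_prod (fun j => pauli (I j)).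

Definition W1 : set 'M[C]_(2 ^ N) :=
  [set X | exists a : multi_index -> R,
     X = \sum_(I : multi_index | weight I == 1%N) (a I)%:C *: sigma_tilde I].

(* Only the values [q k] with 1 <= k <= N are relevant. *)
Definition penalty_metric (q : nat -> R)
    (g : 'M[C]_(2 ^ N) -> 'M[C]_(2 ^ N) -> 'M[C]_(2 ^ N) -> R) : Prop :=
  [/\ forall k, (1 <= k <= N)%N -> 0 < q k,
      riemannian_metric g,
      right_invariant g
    & forall I J : multi_index,
        I != [ffun=> ord0] -> J != [ffun=> ord0] ->
        g 1%:M (sigma_tilde I) (sigma_tilde J) = q (weight I) *+ (I == J)].

Definition binomial_penalty (alpha : R) (k : nat) : R :=
  (('C(N, k) * 3 ^ k)%N%:R : R) `^ alpha.

Definition exponential_penalty (x : R) (k : nat) : R := x ^+ (2 * k).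

End Pauli.

Arguments W1 : clear implicits.

(* Main.v *)
Require Import Defs.
From mathcomp Require Import all_boot all_order all_algebra.
From mathcomp Require Import all_classical all_reals all_analysis.
From mathcomp Require Import complex mxtens.
From mathcomp Require Import ring zify.

(** Write W_1 for the span of the weight-one Pauli strings and phi for the
differential of h at the identity.  An automorphism of SU(2^N) preserves, up to
a scalar, the trace form B(X, Y) = - tr(XY) on su(2^N); an isometry of the
penalty metric moreover preserves the form <X, Y> = g(X, Y) at the identity.
In the Pauli basis B is a multiple of the identity and g is the diagonal matrix
D of the penalty factors.  So if P is the matrix of phi, then P^T P = c and
P^T D P = D.  Comparing traces gives tr D = c tr D, hence c = 1, P is
orthogonal and D P = P D: phi preserves the eigenspaces of D.  When q_1 differs
from every other penalty factor, W_1 is one of these eigenspaces.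

That phi rescales B is obtained without the Killing form or the simplicity of
su(n).  From h(U c(t) U^* ) = h(U) h(c(t)) h(U)^* one gets
phi(U Y U^* ) = h(U) phi(Y) h(U)^*, so the form tr(phi X phi Y) is invariant
under conjugation by SU(n).  Conjugation by a Pauli string changes the signs of
some of the others and makes distinct strings orthogonal ([trace_form_orthogonal]);
conjugation by (X + Y) / sqrt 2 turns X into Y when X and Y are anticommuting
Pauli strings ([exchange_generators]), so that all strings have the same norm
([trace_form_constant]).  The same arguments with phi replaced by the identity
give the orthogonality of the Pauli strings themselves, hence that they span
([sigma_span]).

On the analytic side, a smooth map on SU(n) is only known through local
extensions with continuous iterated directional derivatives.  The mean value
theorem, one coordinate at a time, shows that such a map sends a curve with
velocity v to a curve whose velocity depends linearly on v
([smooth_SU_chain_rule]); this makes the differential a real-linear map.  The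
tangent vectors are all reached with finite products of the one-parameter
groups cos t + sin t Y with Y^2 = -1, which replace the matrix exponential. *)

Set Implicit Arguments.
Unset Strict Implicit.
Unset Printing Implicit Defensive.

Import Order.TTheory GRing.Theory Num.Theory.
Import numFieldNormedType.Exports.

Local Open Scope classical_set_scope.
Local Open Scope ring_scope.
Local Open Scope complex_scope.

(** * Directional derivatives along a curve *)

Section MeanValue.
Variables (R : realType) (E : normedModType R).
Implicit Types (f : E -> R) (e p y : E).

Lemma mvt_line f e y (a : R) :
    (forall s, `|s| <= `|a| -> derivable f (y + s *: e) e) ->
  exists2 s, `|s| <= `|a| & f (y + a *: e) - f y = a * 'D_e f (y + s *: e).
Proof.
move=> hd.
pose u (s : R) := f (y + s *: e).
pose du (s : R) := 'D_e f (y + s *: e).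
(* The difference quotients of [u] at [s] are those of [f] in direction [e]. *)
have quotE s : (fun h : R => h^-1 *: ((u \o shift s) (h *: (1 : R)) - u s)) =
    (fun h : R => h^-1 *: ((f \o shift (y + s *: e)) (h *: e) - f (y + s *: e))).
  apply/funext => h /=; rewrite /u; congr (_ *: (f _ - _)).
  by rewrite [h *: 1]mulr1 scalerDl addrCA.
have hu s : `|s| <= `|a| -> is_derive s (1 : R) u (du s).
  move=> /hd hs; apply: DeriveDef; first by rewrite /derivable quotE.
  by rewrite /derive quotE.
have cu x z : (forall s, s \in `[x, z] -> `|s| <= `|a|) ->
    {within `[x, z], continuous u}.
  move=> hs; apply: derivable_within_continuous => s /hs /hu.
  by move=> [].
case: (leP 0 a) => a0.
  have hs s : s \in `[0, a] -> `|s| <= `|a|.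
    by rewrite in_itv /= => /andP[s0 sa]; rewrite !ger0_norm.
  have [|s sin us] := @MVT_segment R u du 0 a a0 _ (cu _ _ hs).
    by move=> s /subset_itv_oo_cc/hs/hu.
  exists s; first exact: hs.
  by move: us; rewrite /u /du scale0r addr0 subr0 mulrC.
have hs s : s \in `[a, 0] -> `|s| <= `|a|.
  rewrite in_itv /= => /andP[sa s0]; rewrite !ler0_norm ?lerN2 //.
  exact: ltW.
have [|s sin us] := @MVT_segment R u du a 0 (ltW a0) _ (cu _ _ hs).
  by move=> s /subset_itv_oo_cc/hs/hu.
exists s; first exact: hs.
move: us; rewrite /u /du scale0r addr0 sub0r => us.
by rewrite -opprB us mulrN opprK mulrC.
Qed.

(** The basic step of the chain rule: both the base point [y t] and the step
[a t] may move with [t], which is what happens when the increment of a curve is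
split along coordinates.  The mean value theorem writes the increment of [f] as
[a t] times a derivative at a point close to [p]. *)
Lemma cvg_increment_quotient f e p (V : set E) (y : R -> E) (a : R -> R) (da : R) :
    open V -> V p -> (forall x, V x -> derivable f x e) ->
    {for p, continuous ('D_e f)} ->
    y t @[t --> 0^'] --> p -> a t @[t --> 0^'] --> 0 ->
    t^-1 * a t @[t --> 0^'] --> da ->
  t^-1 * (f (y t + a t *: e) - f (y t)) @[t --> 0^'] --> da * 'D_e f p.
Proof.
move=> oV Vp hd hc hy ha hda.
(* Where the step vanishes any value works; the limit keeps [G] convergent. *)
pose G t := if a t == 0 then 'D_e f p else (a t)^-1 * (f (y t + a t *: e) - f (y t)).
have -> : (fun t => t^-1 * (f (y t + a t *: e) - f (y t))) =
    (fun t => t^-1 * a t * G t).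
  apply/funext => t; rewrite /G; case: eqP => [->|/eqP a0].
    by rewrite scale0r addr0 subrr !mulr0 mul0r.
  by rewrite -mulrA mulVKf.
apply: cvgM => //.
apply/cvgrPdist_lt => eps eps0.
have : \forall x \near p, V x /\ `|'D_e f p - 'D_e f x| < eps.
  apply: filterI; first exact: open_nbhs_nbhs.
  by move/cvgrPdist_lt : hc; apply.
move=> /nbhs_ballP[d /= d0 hball].
have d20 : 0 < d / 2 by rewrite divr_gt0.
have near_y : \forall t \near 0^', `|p - y t| < d / 2.
  by move/cvgrPdist_lt : hy; apply.
have near_a : \forall t \near 0^', `|a t| * `|e| < d / 2.
  have /cvgrPdist_lt/(_ (d / 2 / (`|e| + 1))) := ha.
  have e1 : 0 < `|e| + 1 by rewrite ltr_wpDl.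
  rewrite divr_gt0 // => /(_ isT); apply: filterS => t.
  rewrite sub0r normrN ltr_pdivlMr // => h.
  by apply: le_lt_trans h; rewrite ler_wpM2l // lerDl.
near=> t.
rewrite /G; case: eqP => [_|/eqP a0]; first by rewrite subrr normr0.
have inb s : `|s| <= `|a t| -> ball p d (y t + s *: e).
  move=> sa; rewrite -ball_normE /= opprD addrA.
  apply: le_lt_trans (ler_normB _ _) _; rewrite (splitr d) ltrD //.
    by near: t.
  rewrite normrZ; apply: (@le_lt_trans _ _ (`|a t| * `|e|)).
    by rewrite ler_wpM2r.
  by near: t.
have [s sa ->] := @mvt_line f e (y t) (a t) (fun s sa => hd _ (hball _ (inb s sa)).1).
by rewrite mulKf //; have [] := hball _ (inb s sa).
Unshelve. all: by end_near. Qed.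

End MeanValue.

Section ChainRule.
Variables (R : realType) (E : normedModType R).

(** Going from [p] to the point with increments [a i t] one coordinate at a
time telescopes the increment of [f] into [m] steps in fixed directions. *)
Lemma cvg_quotient_along_curve (f : E -> R) (p : E) (V : set E) m (e : 'I_m -> E)
    (a : 'I_m -> R -> R) (da : 'I_m -> R) :
    open V -> V p -> (forall i x, V x -> derivable f x (e i)) ->
    (forall i, {for p, continuous ('D_(e i) f)}) ->
    (forall i, a i t @[t --> 0^'] --> 0) ->
    (forall i, t^-1 * a i t @[t --> 0^'] --> da i) ->
  t^-1 * (f (p + \sum_(i < m) a i t *: e i) - f p) @[t --> 0^'] -->
    \sum_(i < m) da i * 'D_(e i) f p.
Proof.
move=> oV Vp; elim: m e a da => [|m IHm] e a da hd hc ha hda.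
  rewrite big_ord0 (_ : (fun t => _) = cst 0); first exact: cvg_cst.
  by apply/funext => t; rewrite big_ord0 addr0 subrr mulr0.
rewrite big_ord_recr /=.
pose y t := p + \sum_(i < m) a (widen_ord (leqnSn m) i) t *: e (widen_ord (leqnSn m) i).
have -> : (fun t => t^-1 * (f (p + \sum_(i < m.+1) a i t *: e i) - f p)) =
    (fun t => t^-1 * (f (y t) - f p) +
       t^-1 * (f (y t + a ord_max t *: e ord_max) - f (y t))).
  by apply/funext => t; rewrite big_ord_recr /= addrA -/(y t); ring.
apply: cvgD.
  pose w := widen_ord (leqnSn m).
  exact: (IHm (e \o w) (a \o w) (da \o w) (fun i => hd (w i)) (fun i => hc (w i))
            (fun i => ha (w i)) (fun i => hda (w i))).
apply: (cvg_increment_quotient oV Vp (hd _) (hc _) _ (ha _) (hda _)).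
rewrite -[p in _ --> p]addr0; apply: cvgD; first exact: cvg_cst.
rewrite -[X in _ --> X](_ : \sum_(i < m) (0 : R) *: e (widen_ord (leqnSn m) i) = 0).
  apply: cvg_big => [|i _]; first exact: add_continuous.
  by apply: cvgZr_tmp; exact: ha.
by apply: big1 => i _; rewrite scale0r.
Qed.

End ChainRule.

Lemma sum_enum_val (T : finType) (W : nmodType) (F : T -> W) :
  \sum_k F k = \sum_(i < #|T|) F (enum_val i).
Proof. by rewrite -big_enum_val; apply: eq_bigl. Qed.

(** * Derivatives of pairs of matrices, entry by entry *)

Section EntrywiseDerivatives.
Variables (R : realType) (V : normedModType R).

Lemma is_derive_pairP (W1 W2 : normedModType R) (f : V -> W1 * W2) x v d :
  is_derive x v f d <->
  is_derive x v (fun y => (f y).1) d.1 /\ is_derive x v (fun y => (f y).2) d.2.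
Proof.
pose q (W : normedModType R) (g : V -> W) (h : R) :=
  h^-1 *: ((g \o shift x) (h *: v) - g x).
have dP (W : normedModType R) (g : V -> W) (l : W) :
    is_derive x v g l <-> q W g h @[h --> 0^'] --> l.
  split=> [[gd <-]|gl]; first exact: gd.
  by apply: DeriveDef; [apply/cvg_ex; exists l | exact: cvg_lim].
rewrite !dP; split=> [fd|[f1 f2]].
  split; [exact: (cvg_comp _ fst fd (@cvg_fst _ _ _ _ _))|
          exact: (cvg_comp _ snd fd (@cvg_snd _ _ _ _ _))].
by rewrite [d]surjective_pairing; exact: cvg_pair f1 f2.
Qed.

Lemma is_derive_mxP m n (f : V -> 'M[R]_(m, n)) x v d :
  is_derive x v f d <-> forall i j, is_derive x v (fun y => f y i j) (d i j).
Proof.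
split=> [[fd <-] i j|fd].
  have /derivable_mxP fd' := fd.
  by rewrite derive_mx // mxE; exact: derivableP.
have fd' : derivable f x v by apply/derivable_mxP => i j; case: (fd i j).
apply: DeriveDef => //; rewrite derive_mx //; apply/matrixP => i j.
by rewrite mxE; case: (fd i j).
Qed.

Lemma is_derive_mx_pairP m n (f : V -> 'M[R]_(m, n) * 'M[R]_(m, n)) x v d :
  is_derive x v f d <->
  forall i j, is_derive x v (fun y => (f y).1 i j) (d.1 i j) /\
              is_derive x v (fun y => (f y).2 i j) (d.2 i j).
Proof.
split=> [/is_derive_pairP[/is_derive_mxP f1 /is_derive_mxP f2] i j //|fd].
by apply/is_derive_pairP; split; apply/is_derive_mxP => i j; case: (fd i j).
Qed.

Lemma continuous_mx_pair m n (f : V -> 'M[R]_(m, n) * 'M[R]_(m, n)) x :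
  (forall i j, {for x, continuous (fun y => (f y).1 i j)}) ->
  (forall i j, {for x, continuous (fun y => (f y).2 i j)}) ->
  {for x, continuous f}.
Proof.
have mxc (g : V -> 'M[R]_(m, n)) :
    (forall i j, {for x, continuous (fun y => g y i j)}) -> {for x, continuous g}.
  move=> gc; apply/cvgrPdist_le => e e0; near=> y.
  rewrite /Num.Def.normr /= mx_normrE (bigmax_le _ (ltW e0)) //= => i _.
  rewrite !mxE /=; move: i; near: y; apply: filter_forall => /= i.
  exact: ((cvgrPdist_le _ _).1 (gc i.1 i.2)).
move=> /mxc f1 /mxc f2.
have -> : f = (fun y => ((f y).1, (f y).2)) by apply/funext => y; case: (f y).
exact: cvg_pair f1 f2.
Unshelve. all: by end_near. Qed.

End EntrywiseDerivatives.

(** * The chain rule for C^1 maps along a curve *)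

Section ChainRuleMatrices.
Variables (R : realType) (n : nat).
Local Notation E := ('M[R]_n * 'M[R]_n)%type.

(** The index [(true, i, j)] is the entry [(i, j)] of the first component of a
pair, and [(false, i, j)] that of the second one. *)
Definition entry (k : bool * 'I_n * 'I_n) (z : E) : R :=
  if k.1.1 then z.1 k.1.2 k.2 else z.2 k.1.2 k.2.

Definition unit_entry (k : bool * 'I_n * 'I_n) : E :=
  if k.1.1 then (delta_mx k.1.2 k.2, 0) else (0, delta_mx k.1.2 k.2).

Lemma entry_sum (z : E) : z = \sum_k entry k z *: unit_entry k.
Proof.
case: z => A B; rewrite [RHS]surjective_pairing; congr (_, _).
  rewrite (raddf_sum fst); apply/matrixP => i j; rewrite summxE.
  rewrite (bigD1 (true, i, j)) //= !mxE !eqxx mulr1 big1 ?addr0 //.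
  case=> [[[] i'] j'] ne; rewrite /unit_entry /= !mxE ?mulr0 //.
  have /negPf-> : ~~ ((i == i') && (j == j')); last by rewrite mulr0.
  by apply: contra ne => /andP[/eqP-> /eqP->].
rewrite (raddf_sum snd); apply/matrixP => i j; rewrite summxE.
rewrite (bigD1 (false, i, j)) //= !mxE !eqxx mulr1 big1 ?addr0 //.
case=> [[[] i'] j'] ne; rewrite /unit_entry /= !mxE ?mulr0 //.
have /negPf-> : ~~ ((i == i') && (j == j')); last by rewrite mulr0.
by apply: contra ne => /andP[/eqP-> /eqP->].
Qed.

Lemma is_derive_entry (V : normedModType R) (f : V -> E) x v d k :
  is_derive x v f d -> is_derive x v (fun y => entry k (f y)) (entry k d).
Proof.
move=> /is_derive_mx_pairP fd; rewrite /entry.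
by case: k => [[[] i] j] /=; case: (fd i j).
Qed.

Lemma is_derive_of_entries (V : normedModType R) (f : V -> E) x v d :
  (forall k, is_derive x v (fun y => entry k (f y)) (entry k d)) -> is_derive x v f d.
Proof.
move=> fd; apply/is_derive_mx_pairP => i j.
by split; [exact: (fd (true, i, j))|exact: (fd (false, i, j))].
Qed.

Lemma continuous_entry k : continuous (entry k).
Proof.
case: k => [[[] i] j] z; rewrite /entry /=.
  apply: (@cvg_comp _ _ _ (fun z : E => z.1) (fun A : 'M[R]_n => A i j)).
    exact: cvg_fst.
  exact: coord_continuous.
apply: (@cvg_comp _ _ _ (fun z : E => z.2) (fun A : 'M[R]_n => A i j)).
  exact: cvg_snd.
exact: coord_continuous.
Qed.

Lemma is_derive_along_curve_real (f : E -> R) (V : set E) (c : R -> E) (w : E) :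
    open V -> V (c 0) -> (forall k x, V x -> derivable f x (unit_entry k)) ->
    (forall k, {for c 0, continuous ('D_(unit_entry k) f)}) ->
    is_derive (0 : R) (1 : R) c w ->
  is_derive (0 : R) (1 : R) (f \o c) (\sum_k entry k w * 'D_(unit_entry k) f (c 0)).
Proof.
move=> oV Vc hd hc dc.
pose a k t := entry k (c t) - entry k (c 0).
have quot (g : R -> R) d : is_derive (0 : R) (1 : R) g d <->
    t^-1 * (g t - g 0) @[t --> 0^'] --> d.
  have -> : (fun t => t^-1 * (g t - g 0)) =
      (fun h => h^-1 *: ((g \o shift 0) (h *: (1 : R)) - g 0)).
    by apply/funext => t /=; rewrite addr0 [t *: 1]mulr1.
  split=> [[gd <-]|gl]; first exact: gd.
  by apply: DeriveDef; [apply/cvg_ex; exists d | exact: cvg_lim].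
have cE t : c t = c 0 + \sum_k a k t *: unit_entry k.
  rewrite {1}[c t]entry_sum {1}[c 0]entry_sum -big_split /=.
  by apply: eq_bigr => k _; rewrite -scalerDl addrC subrK.
have a0 k : a k t @[t --> 0^'] --> (0 : R).
  rewrite -[X in _ --> X](subrr (entry k (c 0))).
  apply: cvgB; last exact: cvg_cst.
  have cc : {for 0, continuous (fun t : R => entry k (c t))}.
    apply: differentiable_continuous; apply/derivable1_diffP.
    by case: (is_derive_entry k dc).
  exact: cvg_within_filter cc.
have da k : t^-1 * a k t @[t --> 0^'] --> entry k w.
  exact: ((quot _ _).1 (is_derive_entry k dc)).
apply/quot => /=.
have -> : (fun t => t^-1 * (f (c t) - f (c 0))) =
    (fun t => t^-1 * (f (c 0 + \sum_(i < #|{: bool * 'I_n * 'I_n}|)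
       a (enum_val i) t *: unit_entry (enum_val i)) - f (c 0))).
  by apply/funext => t; rewrite [in LHS]cE sum_enum_val.
rewrite sum_enum_val.
exact: (cvg_quotient_along_curve oV Vc (fun i => hd _) (fun i => hc _)
  (fun i => a0 _) (fun i => da _)).
Qed.

(** The velocity of the image curve depends on [c] only through its own velocity
[w], and linearly.  Continuity of the directional derivatives at the base point
plays the part of differentiability there. *)
Lemma is_derive_along_curve (f : E -> E) (V : set E) (c : R -> E) (w : E) :
    open V -> V (c 0) -> Ck 1 V f -> is_derive (0 : R) (1 : R) c w ->
  is_derive (0 : R) (1 : R) (f \o c) (\sum_k entry k w *: 'D_(unit_entry k) f (c 0)).
Proof.
move=> oV Vc [_ f1] dc; apply: is_derive_of_entries => l.
have fl k x : V x -> is_derive x (unit_entry k) (fun y => entry l (f y))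
    (entry l ('D_(unit_entry k) f x)).
  by move=> Vx; apply: is_derive_entry; apply: derivableP; exact: (f1 _).1.
have -> : entry l (\sum_k entry k w *: 'D_(unit_entry k) f (c 0)) =
    \sum_k entry k w * 'D_(unit_entry k) (fun y => entry l (f y)) (c 0).
  rewrite /entry; case: l fl => [[[] i] j] /= fl.
    rewrite (raddf_sum fst) summxE; apply: eq_bigr => k _; rewrite mxE.
    by congr (_ * _); case: (fl k _ Vc).
  rewrite (raddf_sum snd) summxE; apply: eq_bigr => k _; rewrite mxE.
  by congr (_ * _); case: (fl k _ Vc).
apply: (is_derive_along_curve_real oV Vc) => // k.
  by move=> x /(fl k)[].
have : {for c 0, continuous (fun x => entry l ('D_(unit_entry k) f x))}.
  apply: continuous_comp; last exact: continuous_entry.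
  exact: (f1 (unit_entry k)).2.1.
move=> hc; rewrite /prop_for /continuous_at.
rewrite (derive_val (is_derive := fl k _ Vc)).
apply: cvg_trans hc; apply: near_eq_cvg.
have nV : \forall x \near c 0, V x by exact: open_nbhs_nbhs.
near=> x; apply/esym/derive_val; apply: fl.
by near: x; exact: nV.
Unshelve. all: by end_near. Qed.

End ChainRuleMatrices.

Arguments unit_entry {R n} k.

(** * Smooth functions of a real variable *)

Section SmoothRealFunctions.
Variable R : realType.
Implicit Types f g : R^o -> R^o.

Local Notation smooth_real f := (smooth_on_open [set: R^o] (f : R^o -> R^o)).

Lemma Ck_continuous (E F : normedModType R) k (V : set E) (f : E -> F) x :
  Ck k V f -> V x -> {for x, continuous f}.
Proof. by case: k => [|k] [fc _]; exact: fc. Qed.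

Lemma Ck_pred (E F : normedModType R) k (V : set E) (f : E -> F) :
  Ck k.+1 V f -> Ck k V f.
Proof.
elim: k f => [|k IHk] f [fc fd]; split=> // v.
by split; [exact: (fd v).1|apply: IHk; exact: (fd v).2].
Qed.

Lemma Ck_cst (E F : normedModType R) k (V : set E) (w : F) : Ck k V (fun=> w).
Proof.
elim: k w => [|k IHk] w; first by split=> // x _; exact: cst_continuous.
split=> [x _|v]; first exact: cst_continuous.
split=> [x _|]; first exact: derivable_cst.
have -> : (fun x => 'D_v (fun=> w) x) = (fun=> 0).
  by apply/funext => x; exact: derive_cst.
exact: IHk.
Qed.

Lemma CkD (E F : normedModType R) k (f g : E -> F) :
  Ck k setT f -> Ck k setT g -> Ck k setT (fun x => f x + g x).
Proof.
have cont (f' g' : E -> F) l : Ck l setT f' -> Ck l setT g' ->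
    forall x, {for x, continuous (fun x => f' x + g' x)}.
  by move=> f'l g'l x; apply: continuousD; [exact: Ck_continuous f'l _|
                                            exact: Ck_continuous g'l _].
elim: k f g => [|k IHk] f g fk gk.
  by split=> // x _; exact: cont fk gk x.
split=> [x _|v]; first exact: cont fk gk x.
have [fv f'k] := fk.2 v; have [gv g'k] := gk.2 v.
split=> [x _|]; first by apply: derivableD; [exact: fv|exact: gv].
have -> : (fun x => 'D_v (fun x => f x + g x) x) = (fun x => 'D_v f x + 'D_v g x).
  by apply/funext => x; apply: deriveD; [exact: fv|exact: gv].
exact: IHk.
Qed.

Lemma CkM (E : normedModType R) k (f g : E -> R^o) :
  Ck k setT f -> Ck k setT g -> Ck k setT (fun x => f x * g x : R^o).
Proof.
have cont (f' g' : E -> R^o) l : Ck l setT f' -> Ck l setT g' ->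
    forall x, {for x, continuous (fun x => f' x * g' x : R^o)}.
  by move=> f'l g'l x; apply: continuousM; [exact: Ck_continuous f'l _|
                                            exact: Ck_continuous g'l _].
elim: k f g => [|k IHk] f g fk gk.
  by split=> // x _; exact: cont fk gk x.
split=> [x _|v]; first exact: cont fk gk x.
have [fv f'k] := fk.2 v; have [gv g'k] := gk.2 v.
split=> [x _|]; first by apply: derivableM; [exact: fv|exact: gv].
have -> : (fun x => 'D_v (fun x => f x * g x : R^o) x) =
    (fun x => f x * 'D_v g x + g x * 'D_v f x).
  by apply/funext => x; apply: deriveM; [exact: fv|exact: gv].
by apply: CkD; apply: IHk => //; exact: Ck_pred.
Qed.

Lemma is_derive_direction (W : normedModType R) (f : R -> W) (x v : R) d :
  is_derive x (1 : R) f d -> is_derive x v f (v *: d).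
Proof.
move=> [fd <-]; have fd' := (derivable1_diffP _ _).1 fd.
apply: DeriveDef; first exact: diff_derivable.
by rewrite !deriveE // -linearZ /= [v *: 1]mulr1.
Qed.

(** Both trigonometric functions are treated at once because the family of the
functions p cos(at) + r sin(at) is stable under differentiation. *)
Lemma smooth_trigonometric (a p r : R) :
  smooth_real (fun t => p * cos (a * t) + r * sin (a * t)).
Proof.
have d1 (p' r' x : R) : is_derive x (1 : R)
    (fun t => p' * cos (a * t) + r' * sin (a * t))
    (r' * a * cos (a * x) + (- (p' * a)) * sin (a * x)).
  have da : is_derive x (1 : R) (fun t : R => a * t) a.
    by apply: (is_derive_eq (is_deriveZ a (is_derive_id x (1 : R)))); exact: mulr1.
  have dcos : is_derive x (1 : R) (fun t : R => p' * cos (a * t)) (p' * (- sin (a * x) * a)).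
    exact: (is_deriveZ p' (is_derive1_comp (is_derive_cos _) da)).
  have dsin : is_derive x (1 : R) (fun t : R => r' * sin (a * t)) (r' * (cos (a * x) * a)).
    exact: (is_deriveZ r' (is_derive1_comp (is_derive_sin _) da)).
  by apply: (is_derive_eq (is_deriveD dcos dsin)); ring.
have cont (p' r' x : R) :
    {for x, continuous (fun t : R^o => p' * cos (a * t) + r' * sin (a * t) : R^o)}.
  by apply: differentiable_continuous; apply/derivable1_diffP; case: (d1 p' r' x).
move=> k; elim: k p r => [|k IHk] p r; first by split=> // x _; exact: cont.
split=> [x _|v]; first exact: cont.
have dv x := is_derive_direction v (d1 p r x).
split=> [x _|]; first by case: (dv x).
have -> : (fun x : R^o => 'D_v (fun t : R^o => p * cos (a * t) + r * sin (a * t) : R^o) x) =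
    (fun x => (v * (r * a)) * cos (a * x) + (v * - (p * a)) * sin (a * x)).
  by apply/funext => x; rewrite (derive_val (is_derive := dv x)) -!mulrA -mulrDr !mulrA.
exact: IHk.
Qed.

End SmoothRealFunctions.

(** * Curves of complex matrices *)

Section ComplexMatrixCurves.
Variable R : realType.
Local Notation C := R[i].
Local Open Scope sesquilinear_scope.

Lemma ReD (z w : C) : complex.Re (z + w) = complex.Re z + complex.Re w.
Proof. by case: z w => ? ? []. Qed.

Lemma ImD (z w : C) : complex.Im (z + w) = complex.Im z + complex.Im w.
Proof. by case: z w => ? ? []. Qed.

Lemma ReM (z w : C) : complex.Re (z * w) =
  complex.Re z * complex.Re w - complex.Im z * complex.Im w.
Proof. by case: z w => ? ? []. Qed.

Lemma ImM (z w : C) : complex.Im (z * w) =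
  complex.Re z * complex.Im w + complex.Im z * complex.Re w.
Proof. by case: z w => ? ? []. Qed.

Definition smooth_complex (f : R -> C) : Prop :=
  smooth_on_open [set: R^o] ((fun t => complex.Re (f t)) : R^o -> R^o) /\
  smooth_on_open [set: R^o] ((fun t => complex.Im (f t)) : R^o -> R^o).

Definition is_cderive (f : R -> C) (t : R) (d : C) : Prop :=
  is_derive t (1 : R) (fun s => complex.Re (f s)) (complex.Re d) /\
  is_derive t (1 : R) (fun s => complex.Im (f s)) (complex.Im d).

Lemma smooth_complex_cst z : smooth_complex (fun=> z).
Proof. by split=> k; exact: Ck_cst. Qed.

Lemma smooth_complexD f g :
  smooth_complex f -> smooth_complex g -> smooth_complex (fun t => f t + g t).
Proof.
move=> [f1 f2] [g1 g2]; split=> k.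
  under [X in Ck _ _ X]eq_fun do rewrite ReD.
  exact: CkD.
under [X in Ck _ _ X]eq_fun do rewrite ImD.
exact: CkD.
Qed.

Lemma smooth_complexM f g :
  smooth_complex f -> smooth_complex g -> smooth_complex (fun t => f t * g t).
Proof.
move=> [f1 f2] [g1 g2]; split=> k.
  under [X in Ck _ _ X]eq_fun do rewrite ReM -mulN1r.
  by apply: CkD; [exact: CkM|apply: CkM; [exact: Ck_cst|exact: CkM]].
under [X in Ck _ _ X]eq_fun do rewrite ImM.
by apply: CkD; exact: CkM.
Qed.

Lemma smooth_complex_sum (I : Type) (r : seq I) (f : I -> R -> C) :
  (forall i, smooth_complex (f i)) -> smooth_complex (fun t => \sum_(i <- r) f i t).
Proof.
move=> fs; elim: r => [|i r IHr].
  by under [X in smooth_complex X]eq_fun do rewrite big_nil; exact: smooth_complex_cst.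
under [X in smooth_complex X]eq_fun do rewrite big_cons.
exact: smooth_complexD.
Qed.

Lemma is_cderive_cst z t : is_cderive (fun=> z) t 0.
Proof. by split; exact: is_derive_cst. Qed.

Lemma is_cderiveD f g t df dg : is_cderive f t df -> is_cderive g t dg ->
  is_cderive (fun s => f s + g s) t (df + dg).
Proof.
move=> [f1 f2] [g1 g2]; split.
  under [X in is_derive _ _ X]eq_fun do rewrite ReD.
  by rewrite ReD; exact: is_deriveD.
under [X in is_derive _ _ X]eq_fun do rewrite ImD.
by rewrite ImD; exact: is_deriveD.
Qed.

Lemma is_cderiveM f g t df dg : is_cderive f t df -> is_cderive g t dg ->
  is_cderive (fun s => f s * g s) t (df * g t + f t * dg).
Proof.
move=> [f1 f2] [g1 g2]; split.
  under [X in is_derive _ _ X]eq_fun do rewrite ReM.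
  apply: (is_derive_eq (is_deriveB (is_deriveM f1 g1) (is_deriveM f2 g2))).
  by rewrite ReD !ReM /GRing.scale /=; ring.
under [X in is_derive _ _ X]eq_fun do rewrite ImM.
apply: (is_derive_eq (is_deriveD (is_deriveM f1 g2) (is_deriveM f2 g1))).
by rewrite ImD !ImM /GRing.scale /=; ring.
Qed.

Lemma is_cderive_sum (I : Type) (r : seq I) (f : I -> R -> C) t df :
  (forall i, is_cderive (f i) t (df i)) ->
  is_cderive (fun s => \sum_(i <- r) f i s) t (\sum_(i <- r) df i).
Proof.
move=> fs; elim: r => [|i r IHr].
  rewrite big_nil; under [X in is_cderive X]eq_fun do rewrite big_nil.
  exact: is_cderive_cst.
rewrite big_cons; under [X in is_cderive X]eq_fun do rewrite big_cons.
exact: is_cderiveD.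
Qed.

Lemma is_cderive_conj f t d :
  is_cderive f t d -> is_cderive (fun s => Num.conj (f s)) t (Num.conj d).
Proof.
move=> [f1 f2]; split.
  have -> : (fun s => complex.Re (Num.conj (f s))) = (fun s => complex.Re (f s)).
    by apply/funext => s; case: (f s).
  by apply: (is_derive_eq f1); case: (d).
have -> : (fun s => complex.Im (Num.conj (f s))) = (fun s => - complex.Im (f s)).
  by apply/funext => s; case: (f s).
by apply: (is_derive_eq (is_deriveN f2)); case: (d).
Qed.

Section Square.
Variable n : nat.
Local Notation M := 'M[C]_n.

Definition is_mxderive (c : R -> M) (t : R) (v : M) : Prop :=
  forall i j, is_cderive (fun s => c s i j) t (v i j).

Lemma to_realK (A : M) : of_real (to_real A) = A.
Proof. by apply/matrixP => i j; rewrite !mxE; case: (A i j). Qed.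

Lemma of_realK (z : 'M[R]_n * 'M[R]_n) : to_real (of_real z) = z.
Proof.
by case: z => A B; congr (_, _); apply/matrixP => i j; rewrite !mxE.
Qed.

Lemma is_mxderiveP (c : R -> M) t v :
  is_mxderive c t v <-> is_derive t (1 : R) (fun s => to_real (c s)) (to_real v).
Proof.
have re i j : (fun s => (to_real (c s)).1 i j) = (fun s => complex.Re (c s i j)).
  by apply/funext => s; rewrite mxE.
have im i j : (fun s => (to_real (c s)).2 i j) = (fun s => complex.Im (c s i j)).
  by apply/funext => s; rewrite mxE.
rewrite is_derive_mx_pairP; split=> cv i j; have := cv i j.
  by rewrite re im !mxE.
by rewrite re im !mxE.
Qed.

Lemma velocityE (c : R -> M) t v : is_mxderive c t v -> velocity c t = v.
Proof.
by move=> /is_mxderiveP [_ cv]; rewrite /velocity derive1E cv to_realK.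
Qed.

Lemma smooth_curve_mxderive (c : R -> M) t :
  smooth_curve c -> is_mxderive c t (velocity c t).
Proof.
move=> [_ cs]; apply/is_mxderiveP; rewrite of_realK derive1E.
exact/derivableP/((cs 1%N).2 (1 : R)).1.
Qed.

Definition smooth_mx (c : R -> M) : Prop := forall i j, smooth_complex (fun t => c t i j).

(** Entrywise smoothness is stable under matrix products, which is how all the
curves below are built; this lemma turns it into smoothness of the curve in the
real vector space of pairs of matrices. *)
Lemma smooth_mx_curve (c : R -> M) :
  smooth_mx c -> (forall t, SU (c t)) -> smooth_curve c.
Proof.
move=> cs cSU; split=> // k.
have gen (f : R^o -> 'M[R]_n * 'M[R]_n) :
    (forall i j, Ck k setT (fun t => (f t).1 i j : R^o)) ->
    (forall i j, Ck k setT (fun t => (f t).2 i j : R^o)) -> Ck k setT f.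
  elim: k f => [|k IHk] f f1 f2.
    by split=> // x _; apply: continuous_mx_pair => i j; [exact: (f1 i j).1|exact: (f2 i j).1].
  split=> [x _|v].
    by apply: continuous_mx_pair => i j; [exact: (f1 i j).1|exact: (f2 i j).1].
  have fv x : is_derive x v f (\matrix_(i, j) 'D_v (fun t => (f t).1 i j : R^o) x,
                               \matrix_(i, j) 'D_v (fun t => (f t).2 i j : R^o) x).
    apply/is_derive_mx_pairP => i j; rewrite !mxE.
    by split; apply: derivableP; [exact: ((f1 i j).2 v).1|exact: ((f2 i j).2 v).1].
  split=> [x _|]; first by case: (fv x).
  have -> : (fun x => 'D_v f x) = (fun x =>
      (\matrix_(i, j) 'D_v (fun t => (f t).1 i j : R^o) x,
       \matrix_(i, j) 'D_v (fun t => (f t).2 i j : R^o) x)).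
    by apply/funext => x; exact: derive_val.
  apply: IHk => i j /=.
    by under [X in Ck _ _ X]eq_fun do rewrite mxE; exact: ((f1 i j).2 v).2.
  by under [X in Ck _ _ X]eq_fun do rewrite mxE; exact: ((f2 i j).2 v).2.
apply: gen => i j /=; under [X in Ck _ _ X]eq_fun do rewrite mxE.
  exact: (cs i j).1.
exact: (cs i j).2.
Qed.

Lemma smooth_mx_cst (A : M) : smooth_mx (fun=> A).
Proof. by move=> i j; exact: smooth_complex_cst. Qed.

Lemma smooth_mxM (c d : R -> M) :
  smooth_mx c -> smooth_mx d -> smooth_mx (fun t => c t *m d t).
Proof.
move=> cs ds i j; under [X in smooth_complex X]eq_fun do rewrite mxE.
by apply: smooth_complex_sum => k; exact: smooth_complexM.
Qed.

Lemma is_mxderive_cst (A : M) t : is_mxderive (fun=> A) t 0.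
Proof. by move=> i j; rewrite mxE; exact: is_cderive_cst. Qed.

Lemma is_mxderiveM (c d : R -> M) t v w :
  is_mxderive c t v -> is_mxderive d t w ->
  is_mxderive (fun s => c s *m d s) t (v *m d t + c t *m w).
Proof.
move=> cv dw i j; under [X in is_cderive X]eq_fun do rewrite mxE.
rewrite !mxE -big_split /=.
by apply: is_cderive_sum => k; exact: is_cderiveM.
Qed.

Lemma is_mxderive_conj (c : R -> M) t v :
  is_mxderive c t v -> is_mxderive (fun s => (c s) ^t*) t (v ^t*).
Proof.
move=> cv i j; under [X in is_cderive X]eq_fun do rewrite !mxE.
by rewrite !mxE; exact: is_cderive_conj.
Qed.

End Square.
End ComplexMatrixCurves.

(** * The differential at the identity of a smooth self-map of SU(n) *)

Section DifferentialAlongCurves.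
Variables (R : realType) (n : nat).
Local Notation C := R[i].
Local Notation M := 'M[C]_n.
Local Open Scope sesquilinear_scope.

Lemma near_is_mxderive (c d : R -> M) t v :
  (\forall s \near t, c s = d s) -> is_mxderive c t v -> is_mxderive d t v.
Proof.
move=> cd /is_mxderiveP cv; apply/is_mxderiveP.
apply: near_eq_is_derive cv.
by apply: filterS cd => s ->.
Qed.

Lemma SU1 : SU (1%:M : M).
Proof.
split; last exact: det1.
by apply/unitarymxP; rewrite trmx1 map_mx1 mulmx1.
Qed.

(** Near the identity [h] coincides on SU(n) with a map [f] defined on an open
set of matrices; [L] is the linear combination of the directional derivatives of
[f].  It depends on the extension outside of the tangent space, so it is only
claimed to exist. *)
Lemma smooth_SU_chain_rule (h : M -> M) : smooth_SU h ->
  exists L : M -> M,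
    (forall (a : R) v w, L (a%:C *: v + w) = a%:C *: L v + L w) /\
    (forall c v, (forall t, SU (c t)) -> c 0 = 1%:M -> is_mxderive c 0 v ->
       is_mxderive (fun t => h (c t)) 0 (L v)).
Proof.
move=> hs.
have [|V [f [oV V1 fs fh]]] := hs (to_real 1%:M); first by exists 1%:M => //; exact: SU1.
pose Df (w : 'M[R]_n * 'M[R]_n) := \sum_k entry k w *: 'D_(unit_entry k) f (to_real 1%:M).
exists (fun v => of_real (Df (to_real v))); split=> [a v w|c v cSU c0 cv].
  have -> : Df (to_real (a%:C *: v + w)) = a *: Df (to_real v) + Df (to_real w).
    rewrite /Df scaler_sumr -big_split /=; apply: eq_bigr => k _.
    rewrite scalerA -scalerDl; congr (_ *: _).
    case: k => [[[] i] j]; rewrite /entry /= !mxE.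
      by case: (v i j) (w i j) => p q [r s] /=; rewrite mul0r subr0.
    by case: (v i j) (w i j) => p q [r s] /=; rewrite mul0r addr0.
  apply/matrixP => i j; rewrite !mxE.
  by apply/eqP; rewrite eq_complex /= !mul0r subr0 addr0 !eqxx.
apply: (@near_is_mxderive (fun t => of_real (f (to_real (c t))))).
  have cc : {for (0 : R), continuous (fun t => to_real (c t))}.
    apply: differentiable_continuous; apply/derivable1_diffP.
    by have /is_mxderiveP[] := cv.
  have : \forall t \near (0 : R), V (to_real (c t)).
    by apply: cc; rewrite c0; exact: open_nbhs_nbhs.
  apply: filterS => t Vt; rewrite fh //; last by exists (c t).
  by rewrite !to_realK.
apply/is_mxderiveP; rewrite of_realK.
have -> : (fun s => to_real (of_real (f (to_real (c s))))) = f \o (fun s => to_real (c s)).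
  by apply/funext => s; rewrite of_realK.
have := @is_derive_along_curve R n f V (fun t => to_real (c t)) (to_real v) oV.
by rewrite c0 => /(_ V1 (fs 1%N)); apply; exact/is_mxderiveP.
Qed.

(** The chosen velocity in [differential] is that of some curve through the
identity, and all of these curves give the same value. *)
Lemma differential_eq (h L : M -> M) v :
    (forall c v, (forall t, SU (c t)) -> c 0 = 1%:M -> is_mxderive c 0 v ->
       is_mxderive (fun t => h (c t)) 0 (L v)) ->
  tangent 1%:M v -> differential h 1%:M v = L v.
Proof.
move=> hL [c [cs c0 cv]]; rewrite /differential.
case: xgetP => [w -> [d [ds d0 dv ->]]|/(_ (L v)) []].
  apply/velocityE/hL => //; first exact: ds.1.
  by rewrite -dv; exact: smooth_curve_mxderive.
exists c; split=> //; apply/esym/velocityE/hL => //; first exact: cs.1.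
by rewrite -cv; exact: smooth_curve_mxderive.
Qed.

End DifferentialAlongCurves.

(** * One-parameter groups in SU(n) *)

Section SpecialUnitaryCurves.
Variables (R : realType) (n : nat).
Local Notation C := R[i].
Local Notation M := 'M[C]_n.
Local Open Scope sesquilinear_scope.
Implicit Types (U Y Z : M) (h L : M -> M).

Lemma conjmxM (A B : M) : (A *m B) ^t* = B ^t* *m A ^t*.
Proof. by rewrite trmx_mul map_mxM. Qed.

Lemma conjmxD (A B : M) : (A + B) ^t* = A ^t* + B ^t*.
Proof. by rewrite linearD /= map_mxD. Qed.

Lemma conjmxZ (a : C) (A : M) : (a *: A) ^t* = Num.conj a *: A ^t*.
Proof. by rewrite linearZ /= map_mxZ. Qed.

Lemma conj_real_complex (a : R) : Num.conj (a%:C) = a%:C :> C.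
Proof. by rewrite /Num.conj /= oppr0. Qed.

Lemma SUM (U V : M) : SU U -> SU V -> SU (U *m V).
Proof.
move=> [Uu Ud] [Vu Vd]; split; first exact: mul_unitarymx.
by rewrite det_mulmx Ud Vd mulr1.
Qed.

Lemma SU_conj U : SU U -> SU (U ^t*).
Proof.
move=> [Uu Ud]; split; first by rewrite trmxC_unitary.
by rewrite det_map_mx det_tr Ud rmorph1.
Qed.

Lemma SU_mulmx_conj U : SU U -> U *m U ^t* = 1%:M.
Proof. by move=> [/unitarymxP]. Qed.

Lemma SU_conj_mulmx U : SU U -> U ^t* *m U = 1%:M.
Proof. by move=> /SU_mulmx_conj/mulmx1C. Qed.

(** Skew-Hermitian square roots of -1 generate the one-parameter groups
cos t + sin t Y.  The matrix [Z] anticommuting with [Y] conjugates Y to -Y and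
so forces the determinant of these unitary matrices to be 1. *)
Definition generator Y : Prop :=
  [/\ Y *m Y = - 1%:M, Y ^t* = - Y &
      exists2 Z, Z \in unitmx & Z *m Y = - (Y *m Z)].

Definition rotation Y (t : R) : M := (cos t)%:C *: 1%:M + (sin t)%:C *: Y.

Lemma rotation0 Y : rotation Y 0 = 1%:M.
Proof. by rewrite /rotation cos0 sin0 scale1r scale0r addr0. Qed.

Lemma rotationM Y s t : generator Y ->
  rotation Y s *m rotation Y t = rotation Y (s + t).
Proof.
move=> [YY _ _]; rewrite /rotation mulmxDl !mulmxDr -!scalemxAl -!scalemxAr.
rewrite !mul1mx mulmx1 YY cosD sinD !scalerA scalerN.
rewrite [X in _ + X]addrC addrACA -scaleNr -!scalerDl.
by congr (_ *: _ + _ *: _); rewrite -?rmorphM -?rmorphN -?rmorphD //=;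
  congr (_%:C); ring.
Qed.

Lemma SU_rotation Y t : generator Y -> SU (rotation Y t).
Proof.
move=> gY; have [YY Yc [Z Zu ZY]] := gY.
have conjE s : (rotation Y s) ^t* = rotation Y (- s).
  rewrite /rotation conjmxD !conjmxZ !conj_real_complex Yc cosN sinN trmx1 map_mx1.
  by rewrite scalerN rmorphN scaleNr.
split.
  by apply/unitarymxP; rewrite conjE rotationM // subrr rotation0.
(* [Z] conjugates the rotation by [s] to its inverse, so the determinant is its
   own inverse; being the square of the rotation by [t / 2] then fixes the sign. *)
have det2 s : \det (rotation Y s) ^+ 2 = 1.
  have ZE : Z *m rotation Y s = rotation Y (- s) *m Z.
    rewrite /rotation mulmxDr mulmxDl -!scalemxAr -!scalemxAl ZY mulmx1 mul1mx.
    by rewrite cosN sinN rmorphN scaleNr scalerN.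
  have dE : \det (rotation Y s) = \det (rotation Y (- s)).
    apply: (@mulfI _ (\det Z)); first by rewrite -unitfE -unitmxE.
    by rewrite -det_mulmx ZE det_mulmx mulrC.
  by rewrite expr2 {2}dE -det_mulmx rotationM // subrr rotation0 det1.
by rewrite (splitr t) -rotationM // det_mulmx -expr2 det2.
Qed.

Lemma smooth_rotation Y (a : R) : smooth_mx (fun t => rotation Y (a * t)).
Proof.
move=> i j; rewrite /rotation.
under [X in smooth_complex X]eq_fun do rewrite mxE [in X in X + _]mxE [in X in _ + X]mxE.
have sc (f : R^o -> R^o) : smooth_on_open setT f -> smooth_complex (fun t => (f t)%:C).
  by move=> fs; split=> // k; exact: Ck_cst.
apply: smooth_complexD.
  apply: smooth_complexM; last exact: smooth_complex_cst.
  apply: sc => k; have := @smooth_trigonometric R a 1 0 k.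
  by under [X in Ck _ _ X]eq_fun do rewrite mul1r mul0r addr0.
apply: smooth_complexM; last exact: smooth_complex_cst.
apply: sc => k; have := @smooth_trigonometric R a 0 1 k.
by under [X in Ck _ _ X]eq_fun do rewrite mul1r mul0r add0r.
Qed.

Lemma is_mxderive_rotation Y (a : R) :
  is_mxderive (fun t => rotation Y (a * t)) 0 (a%:C *: Y).
Proof.
have da : is_derive (0 : R) (1 : R) (fun t : R => a * t) a.
  by apply: (is_derive_eq (is_deriveZ a (is_derive_id (0 : R) (1 : R)))); exact: mulr1.
have dcos : is_cderive (fun t => (cos (a * t))%:C) 0 0.
  split; last exact: is_derive_cst.
  apply: (is_derive_eq (is_derive1_comp (is_derive_cos (a * 0)) da)).
  by rewrite mulr0 sin0 oppr0 mul0r.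
have dsin : is_cderive (fun t => (sin (a * t))%:C) 0 a%:C.
  split; last exact: is_derive_cst.
  apply: (is_derive_eq (is_derive1_comp (is_derive_sin (a * 0)) da)).
  by rewrite mulr0 cos0 mul1r.
move=> i j; rewrite /rotation.
under [X in is_cderive X]eq_fun do rewrite mxE [in X in X + _]mxE [in X in _ + X]mxE.
have := is_cderiveD (is_cderiveM dcos (is_cderive_cst ((1%:M : M) i j) 0))
                    (is_cderiveM dsin (is_cderive_cst (Y i j) 0)).
have -> : (a%:C *: Y) i j = a%:C * Y i j by rewrite mxE.
by rewrite mul0r !mulr0 !addr0 add0r.
Qed.

(** Tangency at the identity, in the form that is visibly stable under sums:
the product of two curves with smooth entries is again such a curve. *)
Definition smooth_velocity (v : M) : Prop :=
  exists c, [/\ smooth_mx c, forall t, SU (c t), c 0 = 1%:M & is_mxderive c 0 v].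

Lemma smooth_velocity_tangent v : smooth_velocity v -> tangent 1%:M v.
Proof.
move=> [c [cs cSU c0 cv]]; exists c; split=> //; last exact: velocityE.
exact: smooth_mx_curve.
Qed.

Lemma smooth_velocityD v w :
  smooth_velocity v -> smooth_velocity w -> smooth_velocity (v + w).
Proof.
move=> [c [cs cSU c0 cv]] [d [ds dSU d0 dw]].
exists (fun t => c t *m d t); split.
- exact: smooth_mxM.
- by move=> t; exact: SUM.
- by rewrite c0 d0 mulmx1.
by have := is_mxderiveM cv dw; rewrite c0 d0 mulmx1 mul1mx.
Qed.

Lemma smooth_velocity_generator Y (a : R) :
  generator Y -> smooth_velocity (a%:C *: Y).
Proof.
move=> gY; exists (fun t => rotation Y (a * t)); split.
- exact: smooth_rotation.
- by move=> t; exact: SU_rotation.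
- by rewrite mulr0 rotation0.
exact: is_mxderive_rotation.
Qed.

Lemma smooth_velocity_sum (I : Type) (r : seq I) (P : pred I) (a : I -> R) (Y : I -> M) :
  (forall i, P i -> generator (Y i)) ->
  smooth_velocity (\sum_(i <- r | P i) (a i)%:C *: Y i).
Proof.
move=> gY; elim/big_rec: _ => [|i v Pi].
  exists (fun=> 1%:M); split=> // [|t|]; first exact: smooth_mx_cst.
    exact: SU1.
  exact: is_mxderive_cst.
by apply: smooth_velocityD; apply: smooth_velocity_generator; exact: gY.
Qed.

(** A generator is its own rotation by a quarter turn. *)
Lemma generator_SU Y : generator Y -> SU Y.
Proof.
move=> gY; have := SU_rotation (pi / 2) gY.
by rewrite /rotation cos_pihalf sin_pihalf scale0r add0r scale1r.
Qed.

End SpecialUnitaryCurves.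

(** * The differential of an automorphism of SU(n) *)

Section AutomorphismDifferential.
Variables (R : realType) (n : nat).
Local Notation C := R[i].
Local Notation M := 'M[C]_n.
Local Open Scope sesquilinear_scope.
Variables (h L : M -> M).
Hypothesis h_auto : lie_group_automorphism h.
Hypothesis L_linear : forall (a : R) v w, L (a%:C *: v + w) = a%:C *: L v + L w.
Hypothesis L_chain : forall c v, (forall t, SU (c t)) -> c 0 = 1%:M ->
  is_mxderive c 0 v -> is_mxderive (fun t => h (c t)) 0 (L v).

Lemma automorphism_SU U : SU U -> SU (h U).
Proof. by have [[k [hSU _ _ _ _]] _] := h_auto; exact: hSU. Qed.

(** The matrix h(1) is an idempotent unitary matrix. *)
Lemma automorphism1 : h 1%:M = 1%:M.
Proof.
have hh : h 1%:M *m h 1%:M = h 1%:M.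
  by rewrite -h_auto.2 ?mulmx1 //; exact: SU1.
have h1 := automorphism_SU (SU1 R n).
by rewrite -(SU_conj_mulmx h1) -{4}hh mulmxA SU_conj_mulmx // mul1mx.
Qed.

Lemma automorphism_conj U : SU U -> h (U ^t*) = (h U) ^t*.
Proof.
move=> SUU; have hU := automorphism_SU SUU.
rewrite -[h (U ^t*)]mul1mx -(SU_conj_mulmx hU) -mulmxA -h_auto.2 //; last exact: SU_conj.
by rewrite SU_mulmx_conj // automorphism1 mulmx1.
Qed.

(** The curve U c(t) U^* has image h(U) h(c(t)) h(U)^*; both velocities at 0 are
computed, with [c] the one-parameter group of [Y]. *)
Lemma differential_equivariant U Y : SU U -> generator Y ->
  L (U *m Y *m U ^t*) = h U *m L Y *m (h U) ^t*.
Proof.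
move=> SUU gY; have SUc := SU_conj SUU.
pose c t := rotation Y (1 * t).
have cSU t : SU (c t) by exact: SU_rotation.
have c0 : c 0 = 1%:M by rewrite /c mulr0 rotation0.
have cY : is_mxderive c 0 Y by rewrite -[Y]scale1r; exact: is_mxderive_rotation.
have conj_derive (A : M) (d : R -> M) v : is_mxderive d 0 v ->
    is_mxderive (fun t => A *m d t *m A ^t*) 0 (A *m v *m A ^t*).
  move=> dv; have := is_mxderiveM (is_mxderiveM (is_mxderive_cst A 0) dv)
                                  (is_mxderive_cst (A ^t*) 0).
  by rewrite mul0mx add0r mulmx0 addr0.
have /velocityE <- := conj_derive (h U) _ _ (L_chain cSU c0 cY).
have hE : (fun t => h U *m h (c t) *m (h U) ^t*) = (fun t => h (U *m c t *m U ^t*)).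
  apply/funext => t; rewrite -automorphism_conj // -!h_auto.2 //.
  exact: SUM.
rewrite hE; apply/esym/velocityE/L_chain; last exact: conj_derive.
  by move=> t; apply: SUM => //; exact: SUM.
by rewrite c0 mulmx1 SU_mulmx_conj.
Qed.

Lemma differential0 : L 0 = 0.
Proof.
have := L_linear (-1) 0 0; rewrite scaler0 addr0 rmorphN scaleN1r => ->.
by rewrite addNr.
Qed.

Lemma differentialN v : L (- v) = - L v.
Proof.
have := L_linear (-1) v 0.
by rewrite differential0 !addr0 rmorphN !scaleN1r.
Qed.

Lemma differential_sum (I : Type) (r : seq I) (P : pred I) (a : I -> R) (v : I -> M) :
  L (\sum_(i <- r | P i) (a i)%:C *: v i) = \sum_(i <- r | P i) (a i)%:C *: L (v i).
Proof.
apply: (big_rec2 (fun x y => L x = y)) => [|i y x _ <-]; first exact: differential0.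
exact: L_linear.
Qed.

(** The adjoint of h(c(t)) is h(c(t)^* ), and c(t)^* is a curve with velocity
-Y. *)
Lemma differential_skew Y : generator Y -> (L Y) ^t* = - L Y.
Proof.
move=> gY; have [_ Yc _] := gY.
pose c t := rotation Y (1 * t).
have cSU t : SU (c t) by exact: SU_rotation.
have c0 : c 0 = 1%:M by rewrite /c mulr0 rotation0.
have cY : is_mxderive c 0 Y by rewrite -[Y]scale1r; exact: is_mxderive_rotation.
have := is_mxderive_conj (L_chain cSU c0 cY).
have -> : (fun t => (h (c t)) ^t*) = (fun t => h ((c t) ^t*)).
  by apply/funext => t; rewrite automorphism_conj.
move/velocityE => <-; rewrite -differentialN -Yc; apply/velocityE/L_chain.
- by move=> t; exact: SU_conj.
- by rewrite c0 trmx1 map_mx1.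
exact: is_mxderive_conj.
Qed.

End AutomorphismDifferential.

(** * Pauli matrices *)

Section PauliMatrices.
Variable R : realType.
Local Notation C := R[i].
Local Open Scope sesquilinear_scope.
Local Notation mx2 a b c d := (@mx2_of_rows R [:: [:: a; b]; [:: c; d]]).

Definition anticommuting (a b : 'I_4) : bool := [&& a != ord0, b != ord0 & a != b].

Lemma matrix2P (A B : 'M[C]_2) :
  A 0 0 = B 0 0 -> A 0 1 = B 0 1 -> A 1 0 = B 1 0 -> A 1 1 = B 1 1 -> A = B.
Proof.
move=> h00 h01 h10 h11; apply/matrixP => i j.
have ord2 (k : 'I_2) : k = 0 \/ k = 1.
  by case: k => [[|[|//]] hk]; [left|right]; exact: val_inj.
by case: (ord2 i) (ord2 j) => [] -> [] ->.
Qed.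

Lemma mx2_scalar1 : 1%:M = mx2 1 0 0 1.
Proof. by apply: matrix2P; rewrite !mxE. Qed.

Lemma mulmx2 a b c d a' b' c' d' : mx2 a b c d *m mx2 a' b' c' d' =
  mx2 (a * a' + b * c') (a * b' + b * d') (c * a' + d * c') (c * b' + d * d').
Proof. by apply: matrix2P; rewrite mxE big_ord_recl big_ord1 !mxE. Qed.

Lemma scalemx2 k a b c d : k *: mx2 a b c d = mx2 (k * a) (k * b) (k * c) (k * d).
Proof. by apply: matrix2P; rewrite !mxE. Qed.

Lemma conjmx2 a b c d : (mx2 a b c d) ^t* =
  mx2 (Num.conj a) (Num.conj c) (Num.conj b) (Num.conj d).
Proof. by apply: matrix2P; rewrite !mxE. Qed.

Lemma sqr_imaginary : (0 +i* 1 : C) * (0 +i* 1) = -1.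
Proof. exact: sqr_i. Qed.

Lemma conj_imaginary : Num.conj (0 +i* 1 : C) = - (0 +i* 1).
Proof. by apply/eqP; rewrite eq_complex /= oppr0 !eqxx. Qed.

Ltac pauli_cases a := case: a => [[|[|[|[|//]]]] ?]; rewrite /pauli /= ?mx2_scalar1.

Ltac pauli_simp := rewrite ?(mulr0, mul0r, mulr1, mul1r, addr0, add0r, mulrN, mulNr,
  opprK, oppr0, sqr_imaginary, mulN1r).

Lemma pauli_sqr a : pauli R a *m pauli R a = 1%:M.
Proof. by pauli_cases a; rewrite mulmx2; pauli_simp. Qed.

Lemma pauli_conj a : (pauli R a) ^t* = pauli R a.
Proof.
by pauli_cases a; rewrite ?conjmx2 ?trmx1 ?map_mx1 ?rmorphN /= ?conj_imaginary
  ?rmorph0 ?rmorph1 ?opprK.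
Qed.

Lemma pauli_mulC a b :
  pauli R a *m pauli R b = (-1) ^+ anticommuting a b *: (pauli R b *m pauli R a).
Proof.
by pauli_cases a; pauli_cases b;
  rewrite /anticommuting /= ?expr0 ?expr1 !mulmx2 scalemx2; pauli_simp.
Qed.

End PauliMatrices.

(** * Tensor products of 2x2 matrices *)

Section TensorProducts.
Variable R : realType.
Local Notation C := R[i].
Local Open Scope sesquilinear_scope.

Lemma eq_tensor_prod N (A B : 'I_N -> 'M[C]_2) : A =1 B -> tensor_prod A = tensor_prod B.
Proof. by move=> /funext ->. Qed.

Lemma tensor_prod1 N : tensor_prod (fun _ : 'I_N => 1%:M) = 1%:M :> 'M[C]_(2 ^ N).
Proof.
elim: N => [//|N IHN] /=; rewrite IHN; apply/matrixP => i j.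
rewrite castmxE /= !mxE -natrM mulnb; congr (_%:R); congr nat_of_bool.
set u := mxtens_unindex _; set v := mxtens_unindex _.
have -> : (u.1 == v.1) && (u.2 == v.2) = (u == v) by rewrite -pair_eqE.
rewrite (inj_eq (can_inj (@mxtens_unindexK _ _))).
exact: (inj_eq (@cast_ord_inj _ _ _)).
Qed.

Lemma mul_castmx_sqr m m' (e : m = m') (A B : 'M[C]_m) :
  castmx (e, e) A *m castmx (e, e) B = castmx (e, e) (A *m B).
Proof. by case: m' / e. Qed.

Lemma tensor_prodM N (A B : 'I_N -> 'M[C]_2) :
  tensor_prod A *m tensor_prod B = tensor_prod (fun j => A j *m B j).
Proof.
elim: N A B => [|N IHN] A B /=; first by rewrite mulmx1.
by rewrite mul_castmx_sqr tensmx_mul IHN.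
Qed.

Lemma tensor_prodZ N (a : 'I_N -> C) (A : 'I_N -> 'M[C]_2) :
  tensor_prod (fun j => a j *: A j) = (\prod_j a j) *: tensor_prod A.
Proof.
elim: N a A => [|N IHN] a A /=; first by rewrite big_ord0 scale1r.
rewrite (IHN (fun j => a (lift ord0 j)) (fun j => A (lift ord0 j))) big_ord_recl.
by apply/matrixP => i j; rewrite !(castmxE, mxE) /= mulrACA.
Qed.

Lemma tensor_prod_conj N (A : 'I_N -> 'M[C]_2) :
  (tensor_prod A) ^t* = tensor_prod (fun j => (A j) ^t*).
Proof.
elim: N A => [|N IHN] A /=; first by rewrite trmx1 map_mx1.
rewrite -(IHN (fun j => A (lift ord0 j))).
by apply/matrixP => i j; rewrite !(castmxE, mxE) /= rmorphM.
Qed.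

End TensorProducts.

(** * Pauli strings *)

Section PauliStrings.
Variables (R : realType) (N : nat).
Local Notation C := R[i].
Local Notation MI := (multi_index N).
Local Notation sigma := (@sigma_tilde R N).
Local Open Scope sesquilinear_scope.
Implicit Types I J K : MI.

(** Two Pauli strings always commute or anticommute; they anticommute when they
do so at an odd number of positions. *)
Definition commutation_parity I J : bool :=
  \big[addb/false]_j anticommuting (I j) (J j).

Lemma sigma_sqr I : sigma I *m sigma I = - 1%:M.
Proof.
rewrite /sigma_tilde -scalemxAl -scalemxAr scalerA tensor_prodM.
rewrite (eq_tensor_prod (B := fun=> 1%:M)); last by move=> j; exact: pauli_sqr.
by rewrite tensor_prod1 mulrNN sqr_imaginary scaleN1r.
Qed.

Lemma sigma_skew I : (sigma I) ^t* = - sigma I.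
Proof.
rewrite /sigma_tilde conjmxZ tensor_prod_conj.
rewrite (eq_tensor_prod (B := fun j => pauli R (I j))); last by move=> j; exact: pauli_conj.
by rewrite rmorphN /= conj_imaginary opprK scaleNr opprK.
Qed.

Lemma sigma_mulC I J : sigma I *m sigma J =
  (-1) ^+ commutation_parity I J *: (sigma J *m sigma I).
Proof.
rewrite /sigma_tilde -!scalemxAl -!scalemxAr !scalerA !tensor_prodM.
rewrite (eq_tensor_prod (B := fun j => (-1) ^+ anticommuting (I j) (J j) *:
  (pauli R (J j) *m pauli R (I j)))); last by move=> j; exact: pauli_mulC.
rewrite tensor_prodZ scalerA mulrC; congr (_ *: _).
rewrite -[RHS]mulrA; congr (_ * _).
by rewrite (big_morph (fun b : bool => (-1) ^+ b : C) (@signr_addb _)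
  (expr0 _ : (-1) ^+ false = 1 :> C)).
Qed.

Definition single (a : 'I_N) (k : 'I_4) : MI := [ffun j => if j == a then k else ord0].

Lemma parity_single a k I : commutation_parity (single a k) I = anticommuting k (I a).
Proof.
rewrite /commutation_parity (bigD1 a) //= ffunE eqxx big1 ?addbF // => j /negPf ja.
by rewrite ffunE ja.
Qed.

End PauliStrings.

(** * Separating multi-indices by commutation signs *)

Section PauliSeparation.

Ltac ord4_cases a := case: a => [[|[|[|[|//]]]] ?].
Ltac try_ord4 := first [by exists (Ordinal (isT : (1 < 4)%N))
  | by exists (Ordinal (isT : (2 < 4)%N)) | by exists (Ordinal (isT : (3 < 4)%N))].

Lemma anticommuting_separates (a b : 'I_4) : a != b ->
  exists k, anticommuting k a != anticommuting k b.
Proof. by ord4_cases a; ord4_cases b => // _; try_ord4. Qed.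

Lemma anticommuting_common (a b : 'I_4) : a != ord0 -> b != ord0 ->
  exists k, anticommuting k a && anticommuting k b.
Proof. by ord4_cases a; ord4_cases b => // _ _; try_ord4. Qed.

Variable N : nat.
Implicit Types I J : multi_index N.

Lemma multi_index_neqP I J : I != J -> exists a, I a != J a.
Proof.
move=> IJ; apply/existsP; apply: contraR IJ; rewrite negb_exists => /forallP h.
by apply/eqP/ffunP => a; apply/eqP; have := h a; rewrite negbK.
Qed.

Lemma parity_separates I J : I != J ->
  exists K, commutation_parity K I != commutation_parity K J.
Proof.
move=> /multi_index_neqP[a /anticommuting_separates[k hk]].
by exists (single a k); rewrite !parity_single.
Qed.

Lemma parity_common I J a : I a != ord0 -> J a != ord0 ->
  exists K, commutation_parity K I && commutation_parity K J.
Proof.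
move=> Ia Ja; have [k hk] := anticommuting_common Ia Ja.
by exists (single a k); rewrite !parity_single.
Qed.

End PauliSeparation.

(** * Conjugation-invariant trace forms *)

Section Exchange.
Variables (R : realType) (n : nat) (X Y : 'M[R[i]]_n).
Local Open Scope sesquilinear_scope.
Hypotheses (XX : X *m X = - 1%:M) (YY : Y *m Y = - 1%:M).
Hypotheses (Xc : X ^t* = - X) (Yc : Y ^t* = - Y) (YX : Y *m X = - (X *m Y)).

(** Conjugation by (X + Y) / sqrt 2 is the half-turn about the bisector of the
anticommuting matrices [X] and [Y], so it exchanges them.  That matrix is itself
a generator, as it anticommutes with [X *m Y]; hence it is special unitary. *)
Lemma exchange_generators (U := ((Num.sqrt 2)^-1 : R)%:C *: (X + Y)) :
  generator U /\ U *m X *m U ^t* = Y.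
Proof.
pose r : R[i] := ((Num.sqrt 2)^-1 : R)%:C.
have rr : r * r = 2^-1.
  rewrite /r -rmorphM /= -expr2 exprVn sqr_sqrtr ?ler0n //.
  by rewrite fmorphV /= rmorph_nat.
have XYX : X *m Y *m X = Y by rewrite -mulmxA YX mulmxN mulmxA XX mulNmx mul1mx opprK.
have YXY : Y *m (X *m Y) = X by rewrite mulmxA YX mulNmx -mulmxA YY mulmxN mulmx1 opprK.
have XYY : X *m Y *m Y = - X by rewrite -mulmxA YY mulmxN mulmx1.
have XXY : X *m (X *m Y) = - Y by rewrite mulmxA XX mulNmx mul1mx.
have Uc : U ^t* = - U.
  by rewrite /U conjmxZ conj_real_complex conjmxD Xc Yc -opprD scalerN.
have halve (V : 'M[R[i]]_n) : (2^-1 : R[i]) *: (V + V) = V.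
  have -> : V + V = 2%:R *: V by rewrite scaler_nat mulr2n.
  by rewrite scalerA mulVf ?scale1r // pnatr_eq0.
split.
  split=> //.
    rewrite /U -scalemxAl -scalemxAr scalerA rr mulmxDl !mulmxDr XX YY YX.
    rewrite [- (X *m Y) + _]addrC addrACA subrr addr0.
    exact: halve.
  exists (X *m Y).
    have [Xu _] : X \in unitmx /\ - X \in unitmx.
      by apply: mulmx1_unit; rewrite mulmxN XX opprK.
    have [Yu _] : Y \in unitmx /\ - Y \in unitmx.
      by apply: mulmx1_unit; rewrite mulmxN YY opprK.
    by rewrite unitmx_mul Xu.
  rewrite /U -scalemxAl -scalemxAr -scalerN; congr (_ *: _).
  by rewrite mulmxDl mulmxDr XYX XYY YXY XXY opprD opprK.
rewrite Uc mulmxN /U -!scalemxAl -scalemxAr scalerA rr mulmxDl XX YX -opprD.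
rewrite mulNmx scalerN opprK mulmxDl !mulmxDr !mul1mx XYX XYY addrA.
rewrite -[X + Y + Y]addrA [X + (Y + Y)]addrC addrK.
exact: halve.
Qed.

End Exchange.

(** The Pauli strings enter the next arguments only through their commutation
relations, so [sigma] is any family of matrices obeying them. *)
Section TraceForm.
Variables (R : realType) (N n : nat).
Local Notation C := R[i].
Local Notation M := 'M[C]_n.
Local Notation MI := (multi_index N).
Local Open Scope sesquilinear_scope.
Implicit Types I J K : MI.
Variable sigma : MI -> M.
Hypothesis sigma_sqr : forall I, sigma I *m sigma I = - 1%:M.
Hypothesis sigma_skew : forall I, (sigma I) ^t* = - sigma I.
Hypothesis sigma_mulC : forall I J, sigma I *m sigma J =
  (-1) ^+ commutation_parity I J *: (sigma J *m sigma I).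

Lemma sigma_unit I : sigma I \in unitmx.
Proof.
have : sigma I *m (- sigma I) = 1%:M by rewrite mulmxN sigma_sqr opprK.
by move=> /mulmx1_unit[].
Qed.

Lemma sigma_conjugate K I :
  sigma K *m sigma I *m (sigma K) ^t* = (-1) ^+ commutation_parity K I *: sigma I.
Proof.
rewrite sigma_mulC sigma_skew -scalemxAl mulmxN -mulmxA sigma_sqr.
by rewrite mulmxN mulmx1 opprK.
Qed.

Lemma generator_sigma I : I != [ffun=> ord0] -> generator (sigma I).
Proof.
move=> I0; split; [exact: sigma_sqr|exact: sigma_skew|].
have [a] := multi_index_neqP I0; rewrite ffunE => Ia.
have [K /andP[KI _]] := parity_common Ia Ia.
exists (sigma K); first exact: sigma_unit.
by rewrite [LHS]sigma_mulC KI expr1 scaleN1r.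
Qed.

Lemma SU_sigma K : K != [ffun=> ord0] -> SU (sigma K).
Proof. by move=> /generator_sigma/generator_SU. Qed.

Lemma conj_mul_conj (U A B : M) : U ^t* *m U = 1%:M ->
  (U *m A *m U ^t*) *m (U *m B *m U ^t*) = U *m (A *m B) *m U ^t*.
Proof. by move=> UcU; rewrite -!mulmxA [U ^t* *m (U *m _)]mulmxA UcU mul1mx. Qed.

Lemma trace_conj (U A : M) : U ^t* *m U = 1%:M -> \tr (U *m A *m U ^t*) = \tr A.
Proof. by move=> UcU; rewrite mxtrace_mulC mulmxA UcU mul1mx. Qed.

(** Both the identity and the differential of an automorphism have this
property, the former on all matrices and the latter on generators; [P] is there
to cover the two cases together. *)
Definition equivariant (P : M -> Prop) (L : M -> M) : Prop :=
  (forall v, L (- v) = - L v) /\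
  forall U, SU U -> exists2 V, V ^t* *m V = 1%:M &
    forall Y, P Y -> L (U *m Y *m U ^t*) = V *m L Y *m V ^t*.

Section Equivariant.
Variables (P : M -> Prop) (L : M -> M).
Hypothesis L_equiv : equivariant P L.

Lemma equivariant_sign (b : bool) v : L ((-1) ^+ b *: v) = (-1) ^+ b *: L v.
Proof. by case: b; rewrite ?scale1r // expr1 !scaleN1r; exact: L_equiv.1. Qed.

Lemma trace_form_invariant U X Y : SU U -> P X -> P Y ->
  \tr (L (U *m X *m U ^t*) *m L (U *m Y *m U ^t*)) = \tr (L X *m L Y).
Proof.
move=> /L_equiv.2[V VcV hV] PX PY.
by rewrite !hV // conj_mul_conj // trace_conj.
Qed.

Lemma opp_eq_self (z : C) : z = - z -> z = 0.
Proof. by move=> /eqP; rewrite -addr_eq0 -mulr2n mulrn_eq0 => /eqP. Qed.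

(** Some Pauli string commutes with one of the two and anticommutes with the
other; conjugation by it changes the sign of the form at these arguments. *)
Lemma trace_form_orthogonal I J : P (sigma I) -> P (sigma J) -> I != J ->
  \tr (L (sigma I) *m L (sigma J)) = 0.
Proof.
move=> PI PJ IJ; have [K hK] := parity_separates IJ.
have K0 : K != [ffun=> ord0].
  apply: contraNneq hK => ->; rewrite /commutation_parity !big1 // => j _;
  by rewrite ffunE.
have := trace_form_invariant (SU_sigma K0) PI PJ.
rewrite (sigma_conjugate K I) (sigma_conjugate K J) !equivariant_sign.
rewrite -scalemxAl -scalemxAr scalerA linearZ /= -signr_addb; move: hK.
case: (commutation_parity K I) (commutation_parity K J) => [] [] //= _;
  by rewrite expr1 mulN1r => /esym/opp_eq_self.
Qed.

Lemma trace_equivariant_sigma I : P (sigma I) -> I != [ffun=> ord0] -> \tr (L (sigma I)) = 0.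
Proof.
move=> PI I0; have [a] := multi_index_neqP I0; rewrite ffunE => Ia.
have [K /andP[KI _]] := parity_common Ia Ia.
have K0 : K != [ffun=> ord0].
  apply: contraTneq KI => ->; rewrite /commutation_parity big1 // => j _.
  by rewrite ffunE.
have [V VcV hV] := L_equiv.2 _ (SU_sigma K0).
have := trace_conj (L (sigma I)) VcV.
rewrite -hV // sigma_conjugate equivariant_sign KI expr1 scaleN1r linearN /=.
by move=> /esym/opp_eq_self.
Qed.

Lemma trace_form_anticommuting I J : P (sigma I) -> commutation_parity I J ->
  \tr (L (sigma I) *m L (sigma I)) = \tr (L (sigma J) *m L (sigma J)).
Proof.
move=> PI IJ.
have JI : sigma J *m sigma I = - (sigma I *m sigma J).
  by rewrite [in RHS]sigma_mulC IJ expr1 scaleN1r opprK.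
have [gU UI] := exchange_generators (sigma_sqr I) (sigma_sqr J)
  (sigma_skew I) (sigma_skew J) JI.
have := trace_form_invariant (generator_SU gU) PI PI.
by rewrite UI => <-.
Qed.

(** Any nonzero [I] is linked to a multi-index without zero entry by some [K]
anticommuting with both: it suffices to choose [K] supported at one position
where [I] is nonzero. *)
Lemma trace_form_constant I J :
    (forall K, K != [ffun=> ord0] -> P (sigma K)) ->
    I != [ffun=> ord0] -> J != [ffun=> ord0] ->
  \tr (L (sigma I) *m L (sigma I)) = \tr (L (sigma J) *m L (sigma J)).
Proof.
move=> PK; pose F : MI := [ffun=> 1].
suff toF I' : I' != [ffun=> ord0] ->
    \tr (L (sigma I') *m L (sigma I')) = \tr (L (sigma F) *m L (sigma F)).
  by move=> I0 J0; rewrite (toF I I0) (toF J J0).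
move=> I0; have [a] := multi_index_neqP I0; rewrite ffunE => Ia.
have Fa : F a != ord0 by rewrite ffunE.
have [K /andP[KI KF]] := parity_common Ia Fa.
have K0 : K != [ffun=> ord0].
  apply: contraTneq KI => ->; rewrite /commutation_parity big1 // => j _.
  by rewrite ffunE.
rewrite -(@trace_form_anticommuting K I' (PK K K0) KI).
exact: (@trace_form_anticommuting K F (PK K K0) KF).
Qed.

End Equivariant.

Lemma equivariant_id : equivariant (fun=> True) id.
Proof.
by split=> // U SUU; exists U => //; exact: SU_conj_mulmx.
Qed.

Lemma trace_sigmaM I J : \tr (sigma I *m sigma J) = (- n%:R) *+ (I == J).
Proof.
have [->|IJ] := eqVneq I J; first by rewrite sigma_sqr linearN /= mxtrace1.
exact: (trace_form_orthogonal equivariant_id).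
Qed.

Lemma trace_sigma_sum (d : MI -> C) J :
  \tr (sigma J *m \sum_I d I *: sigma I) = - n%:R * d J.
Proof.
rewrite mulmx_sumr linear_sum /= (bigD1 J) //= big1 => [|I IJ].
  by rewrite -scalemxAr linearZ /= trace_sigmaM eqxx addr0 mulrC.
by rewrite -scalemxAr linearZ /= trace_sigmaM eq_sym (negPf IJ) mulr0.
Qed.

Hypothesis n_gt0 : (0 < n)%N.
Hypothesis card_n : #|{: MI}| = (n * n)%N.

(** The Pauli strings are orthogonal for the trace form, hence linearly
independent; they are as many as the dimension of the space of matrices, hence
they span, and orthogonality gives the coefficients. *)
Lemma sigma_span (X : M) :
  X = \sum_I (- (n%:R)^-1 * \tr (sigma I *m X)) *: sigma I.
Proof.
have n0 : n%:R != 0 :> C by rewrite pnatr_eq0 -lt0n.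
pose G : 'M[C]_(#|{: MI}|, n * n) := \matrix_k mxvec (sigma (enum_val k)).
have sumG (d : 'rV[C]_#|{: MI}|) :
    d *m G = mxvec (\sum_I d 0 (enum_rank I) *: sigma I).
  rewrite mulmx_sum_row linear_sum /= [RHS]sum_enum_val.
  by apply: eq_bigr => k _; rewrite rowK linearZ /= enum_valK.
have freeG : row_free G.
  rewrite -kermx_eq0; apply/eqP/row_matrixP => i; rewrite row0.
  have kG : row i (kermx G) *m G = 0 by rewrite -row_mul mulmx_ker row0.
  apply/rowP => k; rewrite [RHS]mxE.
  have := congr1 vec_mx kG; rewrite sumG mxvecK linear0 => s0.
  have := trace_sigma_sum (fun I => row i (kermx G) 0 (enum_rank I)) (enum_val k).
  rewrite s0 mulmx0 linear0 enum_valK mulNr => /esym/eqP.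
  by rewrite oppr_eq0 mulf_eq0 (negPf n0) /= => /eqP.
have fullG : row_full G by rewrite /row_full (eqP freeG) card_n.
have /submxP[d /(congr1 vec_mx)] : (mxvec X <= G)%MS by exact: submx_full.
rewrite sumG !mxvecK => XE.
rewrite {1}XE; apply: eq_bigr => J _; congr (_ *: _).
by rewrite XE trace_sigma_sum mulNr mulrN mulNr opprK mulKf.
Qed.

(** For a skew-Hermitian matrix the numbers tr(sigma_I X) are real, and the one
for I = 0 is a multiple of the trace. *)
Lemma su_span (X : M) : X ^t* = - X -> \tr X = 0 ->
    (sigma [ffun=> ord0] = - (0 +i* 1) *: 1%:M) ->
  exists x : MI -> R, X = \sum_(I | I != [ffun=> ord0]) (x I)%:C *: sigma I.
Proof.
move=> Xc X0 sigma0.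
exists (fun I => complex.Re (- (n%:R)^-1 * \tr (sigma I *m X))).
have tr0 : \tr (sigma [ffun=> ord0] *m X) = 0.
  by rewrite sigma0 -scalemxAl mul1mx linearZ /= X0 mulr0.
rewrite {1}[X]sigma_span (bigD1 [ffun=> ord0]) //= tr0 mulr0 scale0r add0r.
apply: eq_bigr => I _; congr (_ *: _).
have real z : Num.conj z = z -> z = (complex.Re z)%:C.
  by case: z => a b [] /eqP; rewrite eq_sym -addr_eq0 -mulr2n mulrn_eq0 /= => /eqP ->.
apply: real; rewrite rmorphM rmorphN fmorphV rmorph_nat; congr (_ * _).
transitivity (\tr ((sigma I *m X) ^t*)).
  by rewrite trace_map_mx mxtrace_tr.
by rewrite conjmxM Xc sigma_skew mulNmx mulmxN opprK mxtrace_mulC.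
Qed.

End TraceForm.

(** * Matrices orthogonal for two diagonal forms *)

Section CommonDiagonalForms.
Variables (R : realFieldType) (T : finType) (A : pred T) (P : T -> T -> R) (q : T -> R).
Hypothesis q_gt0 : forall i, i \in A -> 0 < q i.
Hypothesis P_orthogonal : forall i j, i \in A -> j \in A -> i != j ->
  \sum_(k in A) P k i * P k j = 0.
Hypothesis P_same_norm : forall i j, i \in A -> j \in A ->
  \sum_(k in A) P k i * P k i = \sum_(k in A) P k j * P k j.
Hypothesis P_isometry : forall i j, i \in A -> j \in A ->
  \sum_(k in A) q k * (P k i * P k j) = q i *+ (i == j).

(** With Q the matrix of [P] and D the diagonal matrix of [q], the hypotheses are
Q^T Q = c and Q^T D Q = D.  Then Q Q^T = c, so that
tr D = tr(D Q Q^T) = c tr D gives c = 1, and D Q = Q Q^T D Q = Q D. *)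
Lemma orthogonal_commutes :
  (forall i j, i \in A -> j \in A -> q i * P i j = P i j * q j) /\
  (forall i j, i \in A -> j \in A -> \sum_(k in A) P i k * P j k = (i == j)%:R).
Proof.
pose m := #|A|.
case: (pickP A) => [i0 Ai0|A0]; last first.
  by split=> i j Ai; move: (A0 i); rewrite [A i]Ai.
pose c := \sum_(k in A) P k i0 * P k i0.
pose Q : 'M[R]_m := \matrix_(i, j) P (enum_val i) (enum_val j).
pose D : 'M[R]_m := diag_mx (\row_i q (enum_val i)).
have Ae (i : 'I_m) : enum_val i \in A by exact: enum_valP.
have QQ : Q^T *m Q = c%:M.
  apply/matrixP => i j; rewrite !mxE.
  under eq_bigr do rewrite !mxE.
  rewrite -(big_enum_val (A := A) (fun k => P k (enum_val i) * P k (enum_val j))).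
  have [->|ij] := eqVneq i j; first by rewrite mulr1n; exact: P_same_norm.
  by rewrite mulr0n P_orthogonal // (inj_eq enum_val_inj).
have QDQ : Q^T *m D *m Q = D.
  apply/matrixP => i j; rewrite mul_mx_diag !mxE.
  under eq_bigr do rewrite !mxE [_ * q _]mulrC -mulrA.
  rewrite -(big_enum_val (A := A) (fun k => q k * (P k (enum_val i) * P k (enum_val j)))).
  by rewrite P_isometry // (inj_eq enum_val_inj).
have c0 : c != 0.
  apply/eqP => c0; have := q_gt0 Ai0.
  have P0 k : k \in A -> P k i0 = 0.
    move=> Ak; have := c0; rewrite /c => /psumr_eq0P h.
    apply/eqP; rewrite -sqrf_eq0 expr2; apply/eqP/h => // k' _.
    by rewrite -expr2 sqr_ge0.
  have := P_isometry Ai0 Ai0; rewrite eqxx mulr1n => <-.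
  by rewrite big1 ?ltxx // => k Ak; rewrite P0 // !mulr0.
have QQt : Q *m Q^T = c%:M.
  have : (c^-1 *: Q^T) *m Q = 1%:M.
    by rewrite -scalemxAl QQ scale_scalar_mx mulVf.
  move=> /mulmx1C; rewrite -scalemxAr => /(congr1 ( *:%R c)).
  by rewrite scalerA mulfV // scale1r scalemx1.
have trD : 0 < \tr D.
  rewrite /mxtrace (bigD1 (enum_rank_in Ai0 i0)) //= ltr_pwDl //.
    by rewrite !mxE eqxx mulr1n q_gt0.
  by apply: sumr_ge0 => i _; rewrite !mxE eqxx mulr1n ltW // q_gt0.
have c1 : c = 1.
  have : \tr D = c * \tr D.
    rewrite -{1}QDQ mxtrace_mulC mulmxA QQt -scalemx1 -scalemxAl mul1mx.
    exact: linearZ.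
  move/eqP; rewrite -subr_eq0 -{1}[\tr D]mul1r -mulrBl mulf_eq0 subr_eq0.
  by rewrite (gt_eqF trD) orbF => /eqP.
have QD : D *m Q = Q *m D by rewrite -{2}QDQ !mulmxA QQt c1 mul1mx.
have Ar i (Ai : i \in A) : enum_val (enum_rank_in Ai0 i) = i by exact: enum_rankK_in.
split=> i j Ai Aj.
  have /matrixP/(_ (enum_rank_in Ai0 i) (enum_rank_in Ai0 j)) := QD.
  by rewrite mul_diag_mx mul_mx_diag !mxE !Ar.
have /matrixP/(_ (enum_rank_in Ai0 i) (enum_rank_in Ai0 j)) := QQt.
rewrite !mxE c1; under eq_bigr do rewrite !mxE.
rewrite !Ar // -(big_enum_val (A := A) (fun k => P i k * P j k)) => ->.
congr (_%:R); congr nat_of_bool; apply/eqP/eqP => [|->//].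
by move=> /(congr1 enum_val); rewrite !Ar.
Qed.

End CommonDiagonalForms.

(** * Weights of multi-indices *)

Section MultiIndices.
Variable N : nat.
Local Notation MI := (multi_index N).
Local Notation I0 := ([ffun=> ord0] : MI).
Implicit Types I : MI.

Lemma card_multi_index : #|{: MI}| = (2 ^ N * 2 ^ N)%N.
Proof. by rewrite card_ffun !card_ord -expnMn. Qed.

Lemma weight_gt0 I : (0 < weight I)%N = (I != I0).
Proof.
apply/card_gt0P/idP => [[j]|/multi_index_neqP[j]].
  by rewrite inE; apply: contraNneq => ->; rewrite ffunE.
by rewrite ffunE => Ij; exists j.
Qed.

Lemma weight_le I : (weight I <= N)%N.
Proof. by rewrite -[X in (_ <= X)%N]card_ord max_card. Qed.

Lemma sigma_tilde0 (R : realType) :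
  sigma_tilde R I0 = - (0 +i* 1) *: 1%:M.
Proof.
rewrite /sigma_tilde (eq_tensor_prod (B := fun=> 1%:M)) ?tensor_prod1 // => j.
by rewrite ffunE.
Qed.

End MultiIndices.

(** * The differential of an isometric automorphism in the Pauli basis *)

Section PauliSystems.
Variables (R : realType) (N n : nat).
Local Notation C := R[i].
Local Notation M := 'M[C]_n.
Local Notation MI := (multi_index N).
Local Notation I0 := ([ffun=> ord0] : MI).
Local Open Scope sesquilinear_scope.
Implicit Types I J K : MI.
Variable sigma : MI -> M.
Hypothesis sigma_sqr : forall I, sigma I *m sigma I = - 1%:M.
Hypothesis sigma_skew : forall I, (sigma I) ^t* = - sigma I.
Hypothesis sigma_mulC : forall I J, sigma I *m sigma J =
  (-1) ^+ commutation_parity I J *: (sigma J *m sigma I).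
Hypothesis n_gt0 : (0 < n)%N.
Hypothesis card_n : #|{: MI}| = (n * n)%N.
Hypothesis sigma0 : sigma I0 = - (0 +i* 1) *: 1%:M.

Let sigma_generator I : I != I0 -> generator (sigma I).
Proof. exact: generator_sigma. Qed.

Definition real_span (a : MI -> R) : M := \sum_(I | I != I0) (a I)%:C *: sigma I.

Lemma tangent_real_span a : tangent 1%:M (real_span a).
Proof.
apply: smooth_velocity_tangent; apply: smooth_velocity_sum => I.
exact: sigma_generator.
Qed.

Lemma tangent_sigma I : I != I0 -> tangent 1%:M (sigma I).
Proof.
move=> /sigma_generator gI; apply: smooth_velocity_tangent.
by have := smooth_velocity_generator 1 gI; rewrite scale1r.
Qed.

Lemma trace_real_span a b : \tr (real_span a *m real_span b) =
  - n%:R * (\sum_(I | I != I0) a I * b I)%:C.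
Proof.
have trS := trace_sigmaM sigma_sqr sigma_skew sigma_mulC.
rewrite /real_span mulmx_suml linear_sum /= rmorph_sum mulr_sumr.
apply: eq_bigr => I In0.
rewrite mulmx_sumr linear_sum (bigD1 I) //= big1 => [|J /andP[_ /negPf JI]].
  rewrite -scalemxAl -scalemxAr scalerA linearZ /= trS eqxx mulr1n addr0.
  by rewrite rmorphM mulrC.
by rewrite -scalemxAl -scalemxAr scalerA linearZ /= trS eq_sym JI mulr0n mulr0.
Qed.

Section Metric.
Variables (q : nat -> R) (g : M -> M -> M -> R).
Hypothesis q_gt0 : forall k, (1 <= k <= N)%N -> 0 < q k.
Hypothesis g_riemannian : riemannian_metric g.
Hypothesis g_sigma : forall I J, I != I0 -> J != I0 ->
  g 1%:M (sigma I) (sigma J) = q (weight I) *+ (I == J).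

Lemma metric_real_span_left a w : tangent 1%:M w ->
  g 1%:M (real_span a) w = \sum_(I | I != I0) a I * g 1%:M (sigma I) w.
Proof.
have [_ gL _ _] := g_riemannian => tw; have SU1' := SU1 R n.
have sv0 : smooth_velocity (0 : M).
  have := @smooth_velocity_sum R n MI [::] xpred0 (fun=> 0) sigma.
  by rewrite big_nil; apply.
have g0 : g 1%:M 0 w = 0.
  have t0 := smooth_velocity_tangent sv0.
  have := gL _ 1 _ _ _ SU1' t0 t0 tw; rewrite scaler0 addr0 mul1r => /eqP.
  by rewrite -subr_eq subrr => /eqP <-.
pose rel (x : M) (y : R) := smooth_velocity x /\ g 1%:M x w = y.
suff [_ ->] : rel (real_span a) (\sum_(I | I != I0) a I * g 1%:M (sigma I) w) by [].
apply: (big_rec2 rel) => [//|I y x In0 [sx gx]]; split.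
  by apply: smooth_velocityD => //; exact: smooth_velocity_generator (sigma_generator In0).
rewrite gL // ?gx //; first exact: tangent_sigma.
exact: smooth_velocity_tangent.
Qed.

Lemma metric_real_span a b : g 1%:M (real_span a) (real_span b) =
  \sum_(I | I != I0) q (weight I) * (a I * b I).
Proof.
have [gC _ _ _] := g_riemannian; have SU1' := SU1 R n.
rewrite metric_real_span_left; last exact: tangent_real_span.
apply: eq_bigr => I In0.
rewrite gC //; [|exact: tangent_sigma|exact: tangent_real_span].
rewrite metric_real_span_left; last exact: tangent_sigma.
rewrite (bigD1 I) //= g_sigma // eqxx mulr1n big1 ?addr0; first by ring.
by move=> J /andP[Jn0 /negPf JI]; rewrite g_sigma // JI mulr0n mulr0.
Qed.

Variable h : M -> M.
Hypothesis h_aut : Aut_SU g h.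

(** The matrix [P] of the differential is orthogonal and commutes with the
diagonal matrix of the penalty factors: the hypotheses of [orthogonal_commutes]
come from the invariant trace form and from the metric. *)
Lemma differential_pauli_matrix : exists P : MI -> MI -> R,
  [/\ forall a, differential h 1%:M (real_span a) =
        real_span (fun K => \sum_(I | I != I0) P K I * a I),
      forall I J, I != I0 -> J != I0 -> q (weight I) * P I J = P I J * q (weight J)
    & forall I J, I != I0 -> J != I0 -> \sum_(K | K != I0) P I K * P J K = (I == J)%:R].
Proof.
have [h_auto [[_ [_ _ _ h_smooth _]] h_iso]] := h_aut.
have [L [L_lin L_chain]] := smooth_SU_chain_rule h_smooth.
have dL v : tangent 1%:M v -> differential h 1%:M v = L v.
  exact: differential_eq.
have L_equiv : equivariant (@generator R n) L.
  split=> [v|U SUU]; first exact: (differentialN L_lin).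
  exists (h U); last by move=> Y; exact: (differential_equivariant h_auto L_chain).
  by apply: SU_conj_mulmx; exact: automorphism_SU.
have L_sigma I : exists p, I != I0 -> L (sigma I) = real_span p.
  have [->|In0] := eqVneq I I0; first by exists (fun=> 0).
  have gI := sigma_generator In0.
  have Lskew := differential_skew h_auto L_lin L_chain gI.
  have Ltr := trace_equivariant_sigma sigma_sqr sigma_skew sigma_mulC L_equiv gI In0.
  have [p Lp] := su_span sigma_sqr sigma_skew sigma_mulC n_gt0 card_n Lskew Ltr sigma0.
  by exists p.
have [P hP] := choice L_sigma.
have L_span a : L (real_span a) = real_span (fun K => \sum_(I | I != I0) P I K * a I).
  rewrite /real_span (differential_sum L_lin).
  transitivity (\sum_(I | I != I0) \sum_(K | K != I0) (P I K * a I)%:C *: sigma K).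
    apply: eq_bigr => I In0; rewrite hP // /real_span scaler_sumr.
    by apply: eq_bigr => K _; rewrite scalerA -rmorphM mulrC.
  rewrite exchange_big /=; apply: eq_bigr => K _.
  by rewrite rmorph_sum scaler_suml.
have n0 : n%:R != 0 :> C by rewrite pnatr_eq0 -lt0n.
pose A : pred MI := fun I => I != I0.
have PA I : I \in A -> I != I0 by [].
have traceE I J : I != I0 -> J != I0 -> \tr (L (sigma I) *m L (sigma J)) =
    - n%:R * (\sum_(K in A) P I K * P J K)%:C.
  by move=> In0 Jn0; rewrite !hP // trace_real_span.
have [||||PQ PP] := @orthogonal_commutes R MI A (fun K I => P I K) (fun I => q (weight I)).
- by move=> I /PA; rewrite -weight_gt0 => w0; apply: q_gt0; rewrite w0 weight_le.
- move=> I J /PA In0 /PA Jn0 IJ.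
  have := trace_form_orthogonal sigma_sqr sigma_skew sigma_mulC L_equiv
    (sigma_generator In0) (sigma_generator Jn0) IJ.
  rewrite traceE // => /eqP; rewrite mulf_eq0 oppr_eq0 (negPf n0) /=.
  by move=> /eqP/complexI.
- move=> I J /PA In0 /PA Jn0.
  have := trace_form_constant sigma_sqr sigma_skew sigma_mulC L_equiv
    sigma_generator In0 Jn0.
  rewrite !traceE // => /mulfI; rewrite oppr_eq0 => /(_ n0)/complexI; exact.
- move=> I J /PA In0 /PA Jn0.
  have := h_iso _ _ _ (SU1 R n) (tangent_sigma In0) (tangent_sigma Jn0).
  rewrite !dL ?(automorphism1 h_auto); [|exact: tangent_sigma..].
  by rewrite !hP // metric_real_span g_sigma.
exists (fun K I => P I K); split=> [a|I J In0 Jn0|I J In0 Jn0].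
- by rewrite dL; [exact: L_span|exact: tangent_real_span].
- exact: PQ.
- exact: PP.
Qed.

Definition weight_one_span : set M := [set X | exists a : MI -> R,
  X = \sum_(I | weight I == 1%N) (a I)%:C *: sigma I].

Let weight1_neq0 I : weight I == 1%N -> I != I0.
Proof. by rewrite -weight_gt0 => /eqP ->. Qed.

Lemma weight_one_spanE (a : MI -> R) :
  (forall I, I != I0 -> weight I != 1%N -> a I = 0) ->
  real_span a = \sum_(I | weight I == 1%N) (a I)%:C *: sigma I.
Proof.
move=> a0; rewrite /real_span (bigID (fun I => weight I == 1%N)) /=.
rewrite [X in _ + X]big1 ?addr0; last first.
  by move=> I /andP[In0 Iw]; rewrite a0 // scale0r.
apply: eq_bigl => I; case Iw: (weight I == 1%N); last by rewrite andbF.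
by rewrite weight1_neq0.
Qed.

Lemma differential_weight_one :
    (forall k, (2 <= k <= N)%N -> q 1%N <> q k) ->
  differential h 1%:M @` weight_one_span = weight_one_span.
Proof.
move=> q1; have [P [dP qP PP]] := differential_pauli_matrix.
have q_neq I : I != I0 -> weight I != 1%N -> q 1%N - q (weight I) != 0.
  move=> In0 Iw; rewrite subr_eq0; apply/eqP; apply: q1; rewrite weight_le andbT.
  by rewrite ltn_neqAle eq_sym Iw weight_gt0.
have P01 I J : I != I0 -> weight I != 1%N -> weight J == 1%N -> P I J = 0.
  move=> In0 Iw Jw; have Jn0 := weight1_neq0 Jw.
  have := qP I J In0 Jn0; rewrite (eqP Jw) => /eqP; rewrite eq_sym mulrC -subr_eq0 -mulrBl.
  by rewrite mulf_eq0 (negPf (q_neq _ In0 Iw)) => /eqP.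
have P10 I J : weight I == 1%N -> J != I0 -> weight J != 1%N -> P I J = 0.
  move=> Iw Jn0 Jw; have In0 := weight1_neq0 Iw.
  have := qP I J In0 Jn0; rewrite (eqP Iw) => /eqP; rewrite [eqbRHS]mulrC -subr_eq0 -mulrBl.
  by rewrite mulf_eq0 (negPf (q_neq _ Jn0 Jw)) => /eqP.
(* [cut] extends by zero the coefficients of a combination of weight-one strings. *)
pose cut (a : MI -> R) I := if weight I == 1%N then a I else 0.
have cutE a : \sum_(I | weight I == 1%N) (a I)%:C *: sigma I = real_span (cut a).
  rewrite weight_one_spanE => [|I _ /negPf Iw]; last by rewrite /cut Iw.
  by apply: eq_bigr => I Iw; rewrite /cut Iw.
rewrite eqEsubset; split=> [_ [X [a ->] <-]|_ [b ->]].
  rewrite cutE dP weight_one_spanE; first by eexists.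
  move=> K Kn0 Kw; apply: big1 => I In0; rewrite /cut.
  by case: ifP => [Iw|_]; [rewrite P01 // mul0r|rewrite mulr0].
(* The preimage is given by the transpose of [P], which is its inverse. *)
exists (real_span (fun I => \sum_(K | K != I0) P K I * cut b K)).
  rewrite weight_one_spanE; first by eexists.
  move=> I In0 Iw; apply: big1 => K Kn0; rewrite /cut.
  by case: ifP => [Kw|_]; [rewrite P10 // mul0r|rewrite mulr0].
rewrite dP cutE /real_span; apply: eq_bigr => J Jn0; congr (_%:C *: _).
under eq_bigr => I _ do rewrite mulr_sumr.
rewrite exchange_big /= (bigD1 J) //= [X in _ + X]big1 ?addr0.
  under eq_bigr => I _ do rewrite mulrA.
  by rewrite -mulr_suml PP // eqxx mul1r.
move=> K /andP[Kn0 /negPf KJ].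
under eq_bigr => I _ do rewrite mulrA.
by rewrite -mulr_suml PP // eq_sym KJ mul0r.
Qed.

End Metric.
End PauliSystems.

(** * Penalty metrics *)

Section PenaltyMetrics.
Variables (R : realType) (N : nat).
Implicit Types g : 'M[R[i]]_(2 ^ N) -> 'M[R[i]]_(2 ^ N) -> 'M[R[i]]_(2 ^ N) -> R.

Lemma penalty_differential_W1 (q : nat -> R) g h :
    penalty_metric q g -> (forall i, (2 <= i <= N)%N -> q 1%N <> q i) -> Aut_SU g h ->
  differential h 1%:M @` W1 R N = W1 R N.
Proof.
move=> [q_gt0 g_riem _ g_sigma] q1 h_aut.
have n_gt0 : (0 < 2 ^ N)%N by rewrite expn_gt0.
exact: (differential_weight_one (@sigma_sqr R N) (@sigma_skew R N) (@sigma_mulC R N)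
  n_gt0 (card_multi_index N) (sigma_tilde0 N R) q_gt0 g_riem g_sigma h_aut q1).
Qed.

(** From k C(N,k) = N C(N-1,k-1) >= N and 3^k > 3k. *)
Lemma binomial_count_lt k : (2 <= k <= N)%N -> ('C(N, 1) * 3 ^ 1 < 'C(N, k) * 3 ^ k)%N.
Proof.
case: k => [//|[//|k]] /andP[_ kN]; rewrite bin1 expn1.
have pow : (3 * k.+2 < 3 ^ k.+2)%N.
  elim: k {kN} => [//|k IHk]; rewrite expnS mulnS.
  have : (3 <= 3 ^ k.+2)%N by rewrite -[X in (X <= _)%N]expn1 leq_exp2l.
  lia.
have bin : (N <= k.+2 * 'C(N, k.+2))%N.
  by rewrite -mul_bin_diag leq_pmulr // bin_gt0; lia.
have bin0 : (0 < 'C(N, k.+2))%N by rewrite bin_gt0.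
nia.
Qed.

Lemma binomial_penalty_neq (alpha : R) k : 0 < alpha -> (2 <= k <= N)%N ->
  binomial_penalty N alpha 1 <> binomial_penalty N alpha k.
Proof.
move=> a0 /binomial_count_lt lt1k; apply/eqP; rewrite lt_eqF //.
by rewrite /binomial_penalty gt0_ltr_powR // ?nnegrE ?ler0n // ltr_nat.
Qed.

Lemma exponential_penalty_neq (x : R) k : 1 < x -> (2 <= k)%N ->
  exponential_penalty x 1 <> exponential_penalty x k.
Proof.
move=> x1 k2; apply/eqP; rewrite lt_eqF // /exponential_penalty.
by rewrite ltr_eXn2l // ltn_pmul2l.
Qed.

End PenaltyMetrics.

Theorem proposition3p8 (R : realType) (N : nat) (hN : (1 <= N)%N) :
  [/\ forall (q : nat -> R)
          (g : 'M[R[i]]_(2 ^ N) -> 'M[R[i]]_(2 ^ N) -> 'M[R[i]]_(2 ^ N) -> R),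
        penalty_metric q g ->
        (forall i : nat, (2 <= i <= N)%N -> q 1%N <> q i) ->
        forall h, Aut_SU g h ->
          differential h 1%:M @` W1 R N = W1 R N,
      forall (alpha : R)
          (g : 'M[R[i]]_(2 ^ N) -> 'M[R[i]]_(2 ^ N) -> 'M[R[i]]_(2 ^ N) -> R),
        0 < alpha -> penalty_metric (binomial_penalty N alpha) g ->
        forall h, Aut_SU g h ->
          differential h 1%:M @` W1 R N = W1 R N
    & forall (x : R)
          (g : 'M[R[i]]_(2 ^ N) -> 'M[R[i]]_(2 ^ N) -> 'M[R[i]]_(2 ^ N) -> R),
        1 < x -> penalty_metric (exponential_penalty x) g ->
        forall h, Aut_SU g h ->
          differential h 1%:M @` W1 R N = W1 R N].
Proof.
split=> [q g g_pen q1 h h_aut|alpha g alpha0 g_pen h h_aut|x g x1 g_pen h h_aut].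
- exact: penalty_differential_W1 g_pen q1 h_aut.
- apply: penalty_differential_W1 g_pen _ h_aut => k kN.
  exact: binomial_penalty_neq.
apply: penalty_differential_W1 g_pen _ h_aut => k /andP[k2 _].
exact: exponential_penalty_neq.
Qed.
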